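(* Let $N\ge 2$ and let $F$ be a marginal distribution on $[0,1]$ as described in the context. Suppose the general robust-version regularity conditions (I) hold: $$f(x)\ \ge\ \frac{x^{-1-\frac{N}{N-1}}}{N-1}\int_0^x s^{\frac{N}{N-1}}f(s)\,ds\quad\text{for all }x\in(0,1),\qquad \Pr(1)\ \ge\ \frac{1}{N-1}\int_{(0,1)}s^{\frac{N}{N-1}}f(s)\,ds.$$ Then the Second Price Auction with $\mathrm{Beta}(\frac{1}{N-1},1)$ Distributed Reserves $(q^*,t^* )$ and the General Adversarial Correlation Structure $\pi^*$ form a Nash equilibrium (saddle point) of the zero-sum game in which the auctioneer chooses an exclusive DSIC and EPIR mechanism and Nature chooses $\pi\in\Pi(F)$: $\pi^*\in\Pi(F)$ and $U((q^*,t^* ),\pi)\ge U((q^*,t^* ),\pi^* )\ge U((q,t),\pi^* )$ for every $\pi\in\Pi(F)$ and every exclusive DSIC and EPIR mechanism $(q,t)$. The revenue guarantee $\inf_{\pi\in\Pi(F)}U((q^*,t^* ),\pi)$ equals $E[X^{\frac{N}{N-1}}]$ with $X\sim F$. In addition, the general robust-version regularity conditions (II) — namely $x^2f(x)$ is non-decreasing on $(0,1)$ and $\Pr(1)\ge\frac{1}{N-1}\int_{(0,1)}s^{\frac{N}{N-1}}f(s)\,ds$ — imply the general robust-version regularity conditions (I).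
   Context: A single indivisible good is sold to $N$ risk-neutral bidders $I=\{1,\dots,N\}$ with private values $v_i\in[0,1]$. All bidders' values have the same marginal cdf $F$ on $[0,1]$ with support $[0,1]$; $F$ may have point masses at $0$ and at $1$ and is absolutely continuous on $(0,1)$ with density $f$; $\Pr(1)$ is the mass of $F$ at $1$ (if $F$ has a mass at $0$, $f(0)$ denotes $\Pr(0)$). $\Pi(F)$ is the set of Borel probability measures on $[0,1]^N$ all of whose one-dimensional marginals equal $F$. A mechanism $(q,t)$ consists of $q:[0,1]^N\to[0,1]^N$ with $\sum_iq_i(v)\le1$ and $t:[0,1]^N\to\mathbb{R}^N$; it is DSIC if $v_iq_i(v)-t_i(v)\ge v_iq_i(v_i',v_{-i})-t_i(v_i',v_{-i})$ for all $i,v,v_i'$, EPIR if $v_iq_i(v)-t_i(v)\ge0$ for all $i,v$, and exclusive if $q_i(v)=0$ whenever $v_i<\max_jv_j$. $U((q,t),\pi)=\int\sum_it_i(v)\,d\pi(v)$. For a profile $v$, $v_{(1)}$ and $v_{(2)}$ denote the highest and second highest entries. Second Price Auction with $\mathrm{Beta}(\frac1{N-1},1)$ Distributed Reserves $(q^*,t^* )$: if exactly one bidder $i$ has $v_i=v_{(1)}$, then $q_i^*(v)=v_{(1)}^{\frac1{N-1}}$, $t_i^*(v)=\frac1Nv_{(1)}^{\frac N{N-1}}+\frac{N-1}Nv_{(2)}^{\frac N{N-1}}$, and $q_j^*=t_j^*=0$ for $j\ne i$; if $K\ge2$ bidders have value $v_{(1)}$, each of them gets $q_i^*(v)=\frac{v_{(1)}^{1/(N-1)}}{K}$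 and pays $t_i^*(v)=\frac1Kv_{(1)}^{\frac N{N-1}}$, and all others get and pay $0$. General Adversarial Correlation Structure $\pi^*$: a symmetric distribution supported on $V^+$, the set of profiles in which either all coordinates are equal, or there is a unique highest coordinate and all other coordinates are equal. It places weight $f(0)$ at $(0,\dots,0)$; for each $i$, on the profiles with $v_i=v_{(1)}\in(0,1)$ and $v_j=v_{(2)}\in(0,v_{(1)}]$ for all $j\neq i$, it has density (w.r.t. Lebesgue measure in the two parameters $(v_{(1)},v_{(2)})$) $\frac{1}{(N-1)v_{(1)}^2}\Big(v_{(2)}f(v_{(2)})-\frac{v_{(2)}^{-\frac N{N-1}}}{N-1}\int_0^{v_{(2)}}s^{\frac N{N-1}}f(s)\,ds\Big)$; for each $i$, on the profiles with $v_i=1$ and $v_j=v_{(2)}\in(0,1)$ for all $j\ne i$, it has density (w.r.t. $dv_{(2)}$) $\frac1{N-1}\Big(v_{(2)}f(v_{(2)})-\frac{v_{(2)}^{-\frac N{N-1}}}{N-1}\int_0^{v_{(2)}}s^{\frac N{N-1}}f(s)\,ds\Big)$; and it has a point mass $\Pr(1)-\frac1{N-1}\int_{(0,1)}s^{\frac N{N-1}}f(s)\,ds$ at $(1,\dots,1)$. It places no weight elsewhere. *)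

(* Defs.v *)
From HB Require Import structures.
From mathcomp Require Import all_boot all_order all_algebra.
From mathcomp Require Import all_classical all_reals all_analysis.

Set Implicit Arguments.
Unset Strict Implicit.
Unset Printing Implicit Defensive.

Import Order.TTheory GRing.Theory Num.Theory.
Local Open Scope classical_set_scope.
Local Open Scope ring_scope.

Section auction_defs.
Variable R : realType.
Variable N : nat.

(* Value profiles v in R^N are N-tuples; N.-tuple R carries the product
   (Borel) sigma-algebra generated by the coordinate projections. *)
Definition profile := N.-tuple R.

Definition pw : R := N%:R / (N.-1)%:R.

Definition cube : set profile := [set v | forall i, 0 <= tnth v i <= 1].

Definition upd (v : profile) (i : 'I_N) (x : R) : profile :=
  [tuple if j == i then x else tnth v j | j < N].

Definition prof_top (i : 'I_N) (a b : R) : profile :=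
  [tuple if j == i then a else b | j < N].

Definition prof_const (c : R) : profile := [tuple c | j < N].

Definition feasible (q : profile -> 'I_N -> R) :=
  forall v, v \in cube -> (forall i, 0 <= q v i <= 1) /\ \sum_(i < N) q v i <= 1.

Definition DSIC (q t : profile -> 'I_N -> R) :=
  forall (i : 'I_N) (v : profile) (x : R), v \in cube -> 0 <= x <= 1 ->
    tnth v i * q (upd v i x) i - t (upd v i x) i <= tnth v i * q v i - t v i.

Definition EPIR (q t : profile -> 'I_N -> R) :=
  forall (i : 'I_N) (v : profile), v \in cube -> 0 <= tnth v i * q v i - t v i.

Definition exclusive (q : profile -> 'I_N -> R) :=
  forall (i : 'I_N) (v : profile), v \in cube ->
    (exists j, tnth v i < tnth v j) -> q v i = 0.

(* admissible strategies of the auctioneer: exclusive, DSIC, EPIR mechanisms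
   (with measurable payments, so that expected revenue is defined) *)
Definition admissible (q t : profile -> 'I_N -> R) :=
  [/\ feasible q, DSIC q t, EPIR q t, exclusive q &
      forall i : 'I_N, measurable_fun setT (fun v : profile => t v i)].

Definition U (P : probability profile R) (t : profile -> 'I_N -> R) : \bar R :=
  (\int[P]_v (\sum_(i < N) t v i)%:E)%E.

Definition inPi (mu : probability R R) (P : probability profile R) :=
  forall (i : 'I_N) (A : set R), measurable A ->
    P [set v : profile | A (tnth v i)] = mu A.

Definition vmax (v : profile) : R := \big[Num.max/0]_(i < N) tnth v i.
Definition ntop (v : profile) : nat := #|[set i : 'I_N | tnth v i == vmax v]|.
Definition vmax_others (v : profile) (i : 'I_N) : R :=
  \big[Num.max/0]_(j < N | j != i) tnth v j.

Definition qstar (v : profile) (i : 'I_N) : R :=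
  if tnth v i == vmax v then (vmax v `^ (N.-1)%:R^-1) / (ntop v)%:R else 0.

Definition tstar (v : profile) (i : 'I_N) : R :=
  if tnth v i == vmax v then
    (if ntop v == 1%N then
       N%:R^-1 * vmax v `^ pw + ((N.-1)%:R / N%:R) * vmax_others v i `^ pw
     else vmax v `^ pw / (ntop v)%:R)
  else 0.

Definition Jint (f : R -> R) (x : R) : \bar R :=
  (\int[lebesgue_measure]_(s in `]0%R, x[) (s `^ pw * f s)%:E)%E.

Definition condI (mu : probability R R) (f : R -> R) :=
  (forall x, 0 < x < 1 ->
     (((x `^ (- 1 - pw)) / (N.-1)%:R)%:E * Jint f x <= (f x)%:E)%E) /\
  (((N.-1)%:R^-1)%:E * Jint f 1 <= mu [set 1%R])%E.

Definition condII (mu : probability R R) (f : R -> R) :=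
  (forall x y, 0 < x -> x <= y -> y < 1 -> x ^+ 2 * f x <= y ^+ 2 * f y) /\
  (((N.-1)%:R^-1)%:E * Jint f 1 <= mu [set 1%R])%E.

Definition gdens (f : R -> R) (b : R) : \bar R :=
  ((b * f b)%:E - ((b `^ (- pw)) / (N.-1)%:R)%:E * Jint f b)%E.

Definition is_pistar (mu : probability R R) (f : R -> R)
    (P : probability profile R) :=
  forall A : set profile, measurable A ->
  P A =
  (mu [set 0%R] * (\1_A (prof_const 0))%:E
   + \sum_(i < N)
       \int[lebesgue_measure]_(a in `]0%R, 1%R[)
         \int[lebesgue_measure]_(b in `]0%R, a])
           ((\1_A (prof_top i a b))%:E
            * (((N.-1)%:R * a ^+ 2)^-1)%:E * gdens f b)
   + \sum_(i < N)
       \int[lebesgue_measure]_(b in `]0%R, 1%R[)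
         ((\1_A (prof_top i 1 b))%:E * ((N.-1)%:R^-1)%:E * gdens f b)
   + (mu [set 1%R] - ((N.-1)%:R^-1)%:E * Jint f 1) * (\1_A (prof_const 1))%:E)%E.

End auction_defs.

Definition Icc01 (R : realType) : set R := `[0%R, 1%R].
Definition Ioo01 (R : realType) : set R := `]0%R, 1%R[.
Definition Ioo (R : realType) (a b : R) : set R := `]a, b[.

(* Main.v *)
(* Along a fibre of the adversarial distribution (bidder i on top with value a, all
   others at b) the weights are da / a^2 on (b, 1) plus an atom at 1, which makes the
   virtual value of the top bidder vanish below 1. Writing u for his indirect
   utility, the payment satisfies tau(a) / a^2 = (u(a) / a)', so the fibre yields at
   most u(1) + tau(1) = q(1) <= 1 whatever the mechanism. On the other side,
   the payments of the auction sum to (v1^p + (N-1) v2^p) / N with p = N / (N-1), which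
   dominates the mean of the v_i^p, with equality on the support of the adversarial
   distribution; the mean has the same expectation E[X^p] under every correlation. *)
Require Import Defs.
From HB Require Import structures.
From mathcomp Require Import all_boot all_order all_algebra.
From mathcomp Require Import all_classical all_reals all_analysis.
From mathcomp Require Import measurable_realfun exp ftc.
From mathcomp Require Import ring lra.

Set Implicit Arguments.
Unset Strict Implicit.
Unset Printing Implicit Defensive.

Import Order.TTheory GRing.Theory Num.Theory.
Import numFieldNormedType.Exports.
Local Open Scope classical_set_scope.
Local Open Scope ring_scope.

(** * Measures prescribed by their integrals of nonnegative functions *)

Section representation.
Context {d : measure_display} {T : measurableType d} {R : realType}.
Local Open Scope ereal_scope.
Implicit Types (L : (T -> \bar R) -> \bar R) (w : T -> \bar R).

(** Two obstacles shape the proof. A competing mechanism has measurable payments, but its allocation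
    may be non-measurable and its payments unbounded below, so neither the envelope formula nor
    integrability of revenue is at hand. The derivative identity is therefore used through
    difference quotients, summed over dyadic partitions with the help of the monotonicity of
    payments along a fibre, and revenue is measured by its shortfall from 1, which is nonnegative on
    the cube. The second obstacle is the adversarial distribution, whose formula is convenient for
    integrals and awkward for sets. It is first a functional on nonnegative functions, a sum of
    atoms and iterated integrals; a measure with these integrals is then produced, and marginals and
    set values are read off the functional. The guarantee arises as follows. With [k = 1 / (N - 1)]
    and [J] the truncated moment of order [p], the fibre over [b] has weight [k * g b], where [g] is
    formally the derivative of [b ^ (- k) * J b]. The fibres of one bidder thus yield at most
    [k * J 1], and [N] bidders with the atom at [(1, ..., 1)] yield [N * k * J 1 + (Pr(1) - k * J 1)
    = J 1 + Pr(1)]. *)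

Definition represents L (nu : {measure set T -> \bar R}) :=
  forall w, measurable_fun setT w -> (forall x, 0 <= w x) ->
    \int[nu]_x w x = L w.

Definition representable L := exists nu, represents L nu.

Lemma representable_add L1 L2 : representable L1 -> representable L2 ->
  representable (fun w => L1 w + L2 w).
Proof.
move=> [m1 h1] [m2 h2]; exists (measure_add m1 m2) => w mw w0.
by rewrite ge0_integral_measure_add// h1// h2.
Qed.

Lemma representable_sum (I : Type) (s : seq I) (L : I -> (T -> \bar R) -> \bar R) :
  (forall i, representable (L i)) ->
  representable (fun w => \sum_(i <- s) L i w).
Proof.
move=> hL; elim: s => [|i s [m hm]].
  exists mzero => w mw w0; rewrite big_nil.
  by rewrite integral_measure_zero.
have [mi hmi] := hL i.
have [n hn] : representable (fun w => L i w + \sum_(j <- s) L j w).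
  by apply: representable_add; [exists mi | exists m].
by exists n => w mw w0; rewrite hn// big_cons.
Qed.

Lemma representable_dirac (c : {nonneg R}) (x : T) :
  representable (fun w => (c%:num)%:E * w x).
Proof.
exists (mscale c (dirac x)) => w mw w0.
by rewrite ge0_integral_mscale// integral_dirac// diracT mul1e.
Qed.

End representation.

Lemma representable_ext d (T : measurableType d) (R : realType)
    (L L' : (T -> \bar R) -> \bar R) :
  (forall w, measurable_fun setT w -> (forall x, 0 <= w x)%E -> L w = L' w) ->
  representable L -> representable L'.
Proof. by move=> LL' [nu hnu]; exists nu => w mw w0; rewrite hnu// LL'. Qed.

Section density.
Context {d : measure_display} {X : measurableType d} {R : realType}.
Variable m : {measure set X -> \bar R}.
Local Open Scope ereal_scope.
Import HBNNSimple.

Lemma representable_density (h : X -> R) :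
  measurable_fun setT h -> (forall x, (0 <= h x)%R) ->
  representable (fun w => \int[m]_x ((h x)%:E * w x)).
Proof.
move=> mh h0.
have mhe : measurable_fun setT (EFin \o h) by exact/measurable_EFinP.
pose nu (A : set X) : \bar R := \int[m]_(x in A) (h x)%:E.
have nu0 : nu set0 = 0 by rewrite /nu integral_set0.
have nu_ge0 A : 0 <= nu A by by apply: integral_ge0 => x _; rewrite lee_fin.
have nu_sigma : semi_sigma_additive nu.
  move=> /= F mF tF mUF; rewrite /nu; apply: cvg_toP.
    apply: ereal_nondecreasing_is_cvgn => k n kn.
    by apply: lee_sum_nneg_natr => // i _ _; exact: nu_ge0.
  by rewrite ge0_integral_bigcup//; [exact: measurable_funTS | move=> x _; rewrite lee_fin].
pose numix := isMeasure.Build d X R nu nu0 nu_ge0 nu_sigma.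
pose nuM : {measure set X -> \bar R} := HB.pack nu numix.
exists nuM => w mw w0.
have indic E : measurable E ->
    \int[nuM]_x (\1_E x)%:E = \int[m]_x ((h x)%:E * (\1_E x)%:E).
  move=> mE; rewrite integral_indic// setIT.
  rewrite -[LHS]/(\int[m]_(x in E) (h x)%:E) integral_mkcond.
  apply: eq_integral => x _; rewrite patchE indicE.
  by case: (x \in E); rewrite ?mule1 ?mule0.
have mhE (g : {nnsfun X >-> R}) : measurable_fun setT (fun x => (h x)%:E * (g x)%:E).
  by apply: emeasurable_funM => //; exact/measurable_EFinP.
have nns (g : {nnsfun X >-> R}) :
    \int[nuM]_x (g x)%:E = \int[m]_x ((h x)%:E * (g x)%:E).
  under [LHS]eq_integral do rewrite fimfunE -fsumEFin//.
  rewrite [LHS]ge0_integral_fsum//; last 2 first.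
    - by move=> r; exact/measurable_EFinP/measurableT_comp.
    - by move=> n x _; rewrite EFinM nnfun_muleindic_ge0.
  under [RHS]eq_integral.
    move=> x _; rewrite fimfunE -fsumEFin// ge0_mule_fsumr; last first.
      by move=> r; rewrite EFinM nnfun_muleindic_ge0.
    over.
  rewrite [RHS]ge0_integral_fsum//; last 2 first.
    - move=> r; apply: emeasurable_funM => //.
      by apply/measurable_EFinP; apply: measurableT_comp.
    - by move=> n x _; rewrite mule_ge0 ?lee_fin ?h0// -lee_fin EFinM nnfun_muleindic_ge0.
  apply: eq_fsbigr => r _.
  (* A negative [r] is not a value of [g], so its preimage is empty and both sides vanish; pulling
     [r] out of the integral requires [0 <= r]. *)
  have [r0|r0] := leP 0%R r; last first.
    rewrite (_ : g @^-1` [set r] = set0); last first.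
      apply/seteqP; split => x //= gx; have : (0 <= g x)%R by [].
      by rewrite gx leNgt r0.
    by rewrite !integral0_eq// => x _; rewrite indic0 mulr0 ?mule0.
  under eq_integral do rewrite EFinM.
  rewrite ge0_integralZl//; last first.
    exact/measurable_EFinP/measurable_indic.
  rewrite indic//.
  under [RHS]eq_integral do rewrite EFinM muleCA.
  rewrite ge0_integralZl//.
  - by apply: emeasurable_funM => //; exact/measurable_EFinP.
  - by move=> x _; rewrite mule_ge0// lee_fin.
pose f_ := nnsfun_approx measurableT mw.
transitivity (lim (\int[nuM]_x (f_ n x)%:E @[n --> \oo])%E).
  rewrite -monotone_convergence//.
  - apply: eq_integral => ? /[!inE] xD; apply/esym/cvg_lim => //=.
    exact: cvg_nnsfun_approx.
  - by move=> n; exact/measurable_EFinP/measurable_funTS.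
  - by move=> n ? _; rewrite lee_fin.
  - by move=> ? _ ? ? mn; rewrite lee_fin; exact/lefP/nd_nnsfun_approx.
under eq_fun do rewrite nns.
rewrite -monotone_convergence//.
- apply: eq_integral => x _; apply/cvg_lim => //=.
  apply: cvgeZl => //; exact: cvg_nnsfun_approx.
- by move=> n x _; rewrite mule_ge0// lee_fin.
- move=> x _ n k nk; rewrite lee_wpmul2l ?lee_fin//.
  exact/lefP/nd_nnsfun_approx.
Qed.

End density.

Section density_pushforward.
Context {d d' : measure_display} {X : measurableType d} {T : measurableType d'}.
Context {R : realType}.
Variable m : {measure set X -> \bar R}.
Local Open Scope ereal_scope.

Lemma representable_density_pushforward (h : X -> R) (phi : X -> T) :
  measurable_fun setT phi ->
  measurable_fun setT h -> (forall x, (0 <= h x)%R) ->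
  representable (fun w => \int[m]_x ((h x)%:E * w (phi x))).
Proof.
move=> mphi mh h0; have [nu hnu] := representable_density m mh h0.
unshelve eexists (pushforward nu phi); first exact: mphi.
move=> w mw w0.
rewrite (ge0_integral_pushforward mphi)// preimage_setT hnu//.
- exact: measurableT_comp.
- by move=> x /=.
Qed.
End density_pushforward.

(** * Tonelli over planar regions described by slices *)

Section tonelli_slices.
Context {d1 d2 : measure_display} {T1 : measurableType d1}.
Context {T2 : measurableType d2} {R : realType}.
Variables (m1 : {sigma_finite_measure set T1 -> \bar R}).
Variables (m2 : {sigma_finite_measure set T2 -> \bar R}).
Variables (E : set (T1 * T2)) (F : T1 * T2 -> \bar R).
Hypotheses (mE : measurable E) (mF : measurable_fun E F).
Hypothesis F0 : forall z, E z -> (0 <= F z)%E.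
Local Open Scope ereal_scope.

Let mFE : measurable_fun setT (F \_ E).
Proof. by apply/(measurable_restrictT _ _).1. Qed.

Let FE0 z : 0 <= (F \_ E) z.
Proof. by rewrite patchE; case: ifPn => // /set_mem/F0. Qed.

Lemma tonelli_slices1 (A : set T1) (B : T1 -> set T2) :
  (forall x y, E (x, y) <-> A x /\ B x y) ->
  \int[m1 \x m2]_(z in E) F z = \int[m1]_(x in A) \int[m2]_(y in B x) F (x, y).
Proof.
move=> EAB; rewrite integral_mkcond fubini_tonelli1// [RHS]integral_mkcond.
apply: eq_integral => x _; rewrite /fubini_F patchE.
case: ifPn => [/set_mem Ax|/negP xA].
  rewrite [RHS]integral_mkcond; apply: eq_integral => y _; rewrite !patchE.
  congr (if _ then _ else _); apply/idP/idP => /set_mem.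
    by move=> /EAB[_ ?]; exact: mem_set.
  by move=> ?; apply/mem_set/EAB.
rewrite integral0_eq// => y _; rewrite patchE ifN//.
by apply/negP => /set_mem/EAB[/mem_set].
Qed.

Lemma tonelli_slices2 (C : set T2) (D : T2 -> set T1) :
  (forall x y, E (x, y) <-> C y /\ D y x) ->
  \int[m1 \x m2]_(z in E) F z = \int[m2]_(y in C) \int[m1]_(x in D y) F (x, y).
Proof.
move=> ECD; rewrite integral_mkcond fubini_tonelli2// [RHS]integral_mkcond.
apply: eq_integral => y _; rewrite /fubini_G patchE.
case: ifPn => [/set_mem Cy|/negP yC].
  rewrite [RHS]integral_mkcond; apply: eq_integral => x _; rewrite !patchE.
  congr (if _ then _ else _); apply/idP/idP => /set_mem.
    by move=> /ECD[_ ?]; exact: mem_set.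
  by move=> ?; apply/mem_set/ECD.
rewrite integral0_eq// => x _; rewrite patchE ifN//.
by apply/negP => /set_mem/ECD[/mem_set].
Qed.

Lemma measurable_slice_integral2 (C : set T2) (D : T2 -> set T1) :
  (forall x y, E (x, y) <-> C y /\ D y x) ->
  measurable_fun C (fun y => \int[m1]_(x in D y) F (x, y)).
Proof.
move=> ECD; apply: (eq_measurable_fun (fun y => \int[m1]_x (F \_ E) (x, y))).
  move=> y /set_mem Cy; rewrite [RHS]integral_mkcond.
  apply: eq_integral => x _; rewrite !patchE.
  congr (if _ then _ else _); apply/idP/idP => /set_mem.
    by move=> /ECD[_ ?]; exact: mem_set.
  by move=> ?; apply/mem_set/ECD.
by apply: measurable_funTS; exact: (measurable_fun_fubini_tonelli_G (F \_ E)).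
Qed.

End tonelli_slices.

(** Describing one region by its slices in both directions allows exchanging integrals whose bounds
    depend on the other variable, as on a triangle. *)
Lemma lebesgue_tonelli (R : realType) (E : set (R * R)) (F : R * R -> \bar R)
    (A C : set R) (B D : R -> set R) :
  measurable E -> measurable_fun E F -> (forall z, E z -> (0 <= F z)%E) ->
  (forall x y, E (x, y) <-> A x /\ B x y) ->
  (forall x y, E (x, y) <-> C y /\ D y x) ->
  (\int[lebesgue_measure]_(x in A) \int[lebesgue_measure]_(y in B x) F (x, y) =
   \int[lebesgue_measure]_(y in C) \int[lebesgue_measure]_(x in D y) F (x, y))%E.
Proof.
move=> mE mF F0 EAB ECD; set leb := @lebesgue_measure R.
transitivity (\int[leb \x leb]_(z in E) F z)%E.
  by apply/esym; exact: (tonelli_slices1 leb leb mE mF F0).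
exact: (tonelli_slices2 leb leb mE mF F0).
Qed.

Lemma measurable_pred d (T : measurableType d) (b : T -> bool) :
  measurable_fun setT b -> measurable [set x | b x].
Proof.
move=> mb; rewrite (_ : [set x | b x] = setT `&` b @^-1` [set true]).
  exact: mb.
by apply/seteqP; split => x /=; tauto.
Qed.

Lemma measurable_invr_sqr (R : realType) (D : set R) :
  measurable_fun D (fun a : R => (a ^+ 2)^-1).
Proof.
apply: measurable_funTS; rewrite (_ : (fun _ => _) = (fun a : R => (a ^+ 2) `^ (-1))).
  exact: (measurableT_comp (measurable_powR _)).
by apply/funext => z; rewrite powR_inv1 ?sqr_ge0.
Qed.

(* Mathcomp's inverse is total with 0^-1 = 0, so the identity holds at 0 too. *)
Lemma measurable_invr (R : realType) (D : set R) :
  measurable_fun D (fun a : R => a^-1).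
Proof.
rewrite (_ : (fun _ => _) = (fun a : R => a * (a ^+ 2)^-1)).
  by apply: measurable_funM => //; exact: measurable_invr_sqr.
apply/funext => a; have [->|a0] := eqVneq a 0; first by rewrite invr0 mul0r.
by field.
Qed.

(** * Integrals of powers *)

Section powR_integral.
Context {R : realType}.
Local Notation leb := (@lebesgue_measure R).
Implicit Types r a b : R.

Lemma powR_continuousT r (a : R) : 0 < a -> {for a, continuous (@powR R ^~ r)}.
Proof.
move=> a0; apply: differentiable_continuous; apply/derivable1_diffP.
by apply: derivable_powR; rewrite in_itv/= a0.
Qed.

Lemma integral_powR_cc r a b : r != 0 -> 0 < a -> a < b ->
  (\int[leb]_(x in `[a, b]) (x `^ (r - 1))%:E = ((b `^ r - a `^ r) / r)%:E)%E.
Proof.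
move=> r0 a0 ab.
have gt0 (x : R) : a <= x -> 0 < x by exact: lt_le_trans.
pose F := (r^-1 *: (@powR R ^~ r)) : R -> R.
have cF (x : R) : 0 < x -> {for x, continuous F}.
  move=> x0; apply: cvgZr; exact: powR_continuousT.
have dF (x : R) : 0 < x -> is_derive x (1 : R) F (x `^ (r - 1)).
  move=> x0.
  have := is_deriveZ (r^-1) (is_derive1_powR r x0).
  by rewrite /GRing.scale/= mulrA mulVf// mul1r.
rewrite (@continuous_FTC2 _ _ F)//.
- rewrite -EFinB; congr EFin; rewrite mulrC mulrBr //.
- apply: continuous_in_subspaceT => x; rewrite inE/= in_itv/= => /andP[ax _].
  by apply: powR_continuousT; exact: gt0.
- split.
  + move=> x; rewrite in_itv/= => /andP[/ltW/gt0/dF[]//].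
  + by apply: cvg_at_right_filter; exact: cF.
  + by apply: cvg_at_left_filter; apply: cF; exact: lt_trans ab.
- move=> x; rewrite in_itv/= => /andP[/ltW/gt0 x0 _].
  by rewrite derive1E; apply: (@derive_val _ _ _ _ _ _ _ (dF _ x0)).
Qed.

Lemma measurable_powR_EFin r (D : set R) :
  measurable_fun D (fun x : R => (x `^ r)%:E).
Proof. by apply/measurable_EFinP; exact: measurable_funTS. Qed.

Lemma integral_powR_itv r a b (b0 b1 : bool) : r != 0 -> 0 < a -> a <= b ->
  (\int[leb]_(x in [set` Interval (BSide b0 a) (BSide b1 b)]) (x `^ (r - 1))%:E =
   ((b `^ r - a `^ r) / r)%:E)%E.
Proof.
move=> r0 a0; rewrite le_eqVlt => /predU1P[<-|ab].
  rewrite integral_itv_bndoo; last exact: measurable_powR_EFin.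
  by rewrite subrr mul0r set_itvoo0 integral_set0.
rewrite -(integral_powR_cc r0 a0 ab).
rewrite [LHS]integral_itv_bndoo; last exact: measurable_powR_EFin.
by rewrite [RHS]integral_itv_bndoo//; exact: measurable_powR_EFin.
Qed.

Lemma integral_inv_sqr_itv a b (b0 b1 : bool) : 0 < a -> a <= b ->
  (\int[leb]_(x in [set` Interval (BSide b0 a) (BSide b1 b)]) ((x ^+ 2)^-1)%:E =
   (a^-1 - b^-1)%:E)%E.
Proof.
move=> a0 ab; have b_gt0 := lt_le_trans a0 ab.
rewrite integral_itv_bndoo; last first.
  by apply/measurable_EFinP; exact: measurable_invr_sqr.
transitivity (\int[leb]_(x in `]a, b[) (x `^ (-1 - 1))%:E)%E.
  apply: eq_integral => x; rewrite inE/= in_itv/= => /andP[ax _].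
  rewrite (_ : -1 - 1 = - 2%:R) ?powR_invn ?(le_trans (ltW a0) (ltW ax))//.
  by ring.
rewrite integral_powR_itv ?oppr_eq0 ?oner_eq0//; congr EFin.
by rewrite !powR_inv1 ?ltW//; field; rewrite !gt_eqF.
Qed.

End powR_integral.

(** For [r < 1] the integrand is unbounded near 0. The interval is exhausted by the intervals from
    [1 / (n + 1)] to [x], and the nonpositive term at the lower endpoint is dropped. *)
Lemma integral_powR_le (R : realType) (r x : R) : 0 < r -> 0 < x ->
  (\int[lebesgue_measure]_(s in `]0%R, x[) (s `^ (r - 1))%:E <= (x `^ r / r)%:E)%E.
Proof.
move=> r0 x0; rewrite itv_open_bnd_bigcup.
set F := fun n : nat => [set` _].
have F0 n s : F n s -> (0 <= (s `^ (r - 1))%:E)%E.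
  by move=> _; rewrite lee_fin powR_ge0.
have ndF : nondecreasing_seq F.
  move=> m n mn; apply/subsetPset => s; rewrite /F/= !in_itv/= => /andP[ms ->].
  rewrite andbT; apply: le_trans ms; rewrite lerD2l lef_pV2 ?posrE//.
  by rewrite ler_nat.
have mF n : measurable (F n) by exact: measurable_itv.
have mf n : measurable_fun (F n) (fun s : R => (s `^ (r - 1))%:E).
  exact: measurable_powR_EFin.
have /cvg_lim <-// := ge0_nondecreasing_set_cvg_integral
  (mu := @lebesgue_measure R) ndF mF mf F0; apply: lime_le.
  apply: ereal_nondecreasing_is_cvgn.
  exact: ge0_nondecreasing_set_nondecreasing_integral.
apply: nearW => n; rewrite /F add0r.
have n0 : 0 < n.+1%:R^-1 :> R by [].
have [nx|xn] := leP n.+1%:R^-1 x.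
  rewrite integral_powR_itv// ?gt_eqF// lee_fin ler_wpM2r ?invr_ge0 ?(ltW r0)//.
  by rewrite gerBl powR_ge0.
rewrite set_itv_ge ?integral_set0 ?lee_fin ?divr_ge0 ?powR_ge0 ?(ltW r0)//.
by rewrite bnd_simp -leNgt ltW.
Qed.

(** * The density of the adversarial distribution and integration along its fibres *)

(* Here k stands for 1 / (N - 1), so that N / (N - 1) = 1 + k. *)
Section correlation_density.
Context {R : realType}.
Variables (k : R) (f : R -> R).
Local Notation leb := (@lebesgue_measure R).
Hypotheses (k_gt0 : 0 < k) (mf : measurable_fun setT f).
Hypotheses (f_ge0 : forall x, 0 <= f x) (f_out : forall x, 1 <= x -> f x = 0).
Hypothesis f_le1 : (\int[leb]_x (f x)%:E <= 1)%E.

Definition truncated_moment (x : R) : \bar R :=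
  (\int[leb]_(s in `]0%R, x[) (s `^ (1 + k) * f s)%:E)%E.
Local Notation J := truncated_moment.
Local Notation Jr x := (fine (J x)).

(** Formally the derivative of [b ^ (- k) * J b], which explains all integrals of it below. *)
Definition second_density (b : R) : R :=
  b * f b - k * b `^ (- (1 + k)) * Jr b.
Local Notation g := second_density.

Lemma measurable_moment_integrand (D : set R) :
  measurable_fun D (fun s : R => (s `^ (1 + k) * f s)%:E).
Proof.
apply/measurable_EFinP; apply: measurable_funM; first exact: measurable_funTS.
exact: measurable_funS mf.
Qed.

Lemma truncated_moment_ge0 x : (0 <= J x)%E.
Proof. by apply: integral_ge0 => s _; rewrite lee_fin mulr_ge0// powR_ge0. Qed.

(** On (0, 1) the weight [s ^ (1 + k)] is at most 1, so the total mass of [f] bounds the moment. The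
    resulting finiteness makes [fine] faithful. *)
Lemma truncated_moment_le1 x : (J x <= 1)%E.
Proof.
apply: le_trans f_le1.
apply: (@le_trans _ _ (\int[leb]_(s in `]0%R, x[) (f s)%:E)%E).
  apply: ge0_le_integral => //.
  - by move=> s _; rewrite lee_fin mulr_ge0// powR_ge0.
  - exact: measurable_moment_integrand.
  - by apply/measurable_EFinP; exact: measurable_funS mf.
  - move=> s; rewrite /= in_itv/= => /andP[s0 _]; rewrite lee_fin.
    have [s1|s1] := leP 1 s; first by rewrite f_out// mulr0.
    rewrite ler_piMl// (@le_trans _ _ s) ?(ltW s1)// ge1r_powR ?s0 ?(ltW s1)//.
    by rewrite lerDl ltW.
apply: ge0_subset_integral => //.
- exact/measurable_EFinP.
- by move=> s _; rewrite lee_fin.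
Qed.

Lemma truncated_moment_fin_num x : J x \is a fin_num.
Proof.
rewrite ge0_fin_numE ?truncated_moment_ge0//.
by apply: le_lt_trans (truncated_moment_le1 x) _; rewrite ltry.
Qed.

Lemma truncated_moment_fineK x : (Jr x)%:E = J x.
Proof. by rewrite fineK// truncated_moment_fin_num. Qed.

Lemma fine_truncated_moment_ge0 x : 0 <= Jr x.
Proof. by rewrite fine_ge0// truncated_moment_ge0. Qed.

Lemma moment_kernel_ge0 b : 0 <= k * b `^ (- (1 + k)) * Jr b.
Proof.
by rewrite mulr_ge0 ?fine_truncated_moment_ge0// mulr_ge0 ?powR_ge0// ltW.
Qed.

Lemma measurable_truncated_moment (D : set R) : measurable D ->
  measurable_fun D (fun x => Jr x).
Proof.
move=> mD; apply: nondecreasing_measurable => // x y xy.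
rewrite -lee_fin !truncated_moment_fineK; apply: ge0_subset_integral => //.
- exact: measurable_moment_integrand.
- by move=> s _; rewrite lee_fin mulr_ge0// powR_ge0.
- by apply: subset_itvl; rewrite bnd_simp.
Qed.

Lemma measurable_second_density : measurable_fun setT g.
Proof.
apply: measurable_funB; first exact: measurable_funM.
apply: measurable_funM; last exact: measurable_truncated_moment.
exact: measurable_funM.
Qed.

(** An integration by parts for a merely measurable [f]: after exchanging the integrals, the kernel
    integrates over [b] in []s, x[] to [s ^ (- k) - x ^ (- k)]. Stating it as a sum avoids
    subtraction of extended reals. *)
Lemma integral_moment_kernel x : 0 < x -> x <= 1 ->
  (\int[leb]_(b in `]0%R, x[) (k * b `^ (- (1 + k)) * Jr b)%:E
   + (x `^ (- k))%:E * J x = \int[leb]_(s in `]0%R, x[) (s * f s)%:E)%E.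
Proof.
move=> x0 x1.
pose E : set (R * R) := [set z | (0 < z.2) && (z.2 < z.1) && (z.1 < x)].
pose F (z : R * R) : \bar R :=
  ((k * z.1 `^ (- (1 + k))) * (z.2 `^ (1 + k) * f z.2))%:E.
have mE : measurable E.
  apply: measurable_pred.
  apply: measurable_and; last by apply: measurable_fun_ltr.
  by apply: measurable_and; apply: measurable_fun_ltr.
have mF : measurable_fun E F.
  apply: measurable_funTS; apply/measurable_EFinP.
  apply: measurable_funM.
    apply: measurable_funM => //.
    exact: (measurableT_comp (measurable_powR _)).
  apply: measurable_funM.
    exact: (measurableT_comp (measurable_powR _)).
  exact: (measurableT_comp mf).
have F0 z : E z -> (0 <= F z)%E.
  by move=> _; rewrite lee_fin !mulr_ge0// ?powR_ge0// ltW.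
transitivity (\int[leb]_(b in `]0%R, x[) \int[leb]_(s in `]0%R, b[) F (b, s)
     + (x `^ (- k))%:E * J x)%E.
  congr (_ + _)%E; apply: eq_integral => b _.
  rewrite EFinM truncated_moment_fineK /J -ge0_integralZl//.
  - exact: measurable_moment_integrand.
  - by move=> s _; rewrite lee_fin mulr_ge0// powR_ge0.
  - by rewrite lee_fin mulr_ge0 ?powR_ge0// ltW.
rewrite (@lebesgue_tonelli R E F `]0%R, x[ `]0%R, x[ (fun b => `]0%R, b[%classic)
  (fun s => `]s, x[%classic))//; last 2 first.
- move=> b s; rewrite /E/= !in_itv/=; split.
    by move=> /andP[/andP[s0 sb] bx]; rewrite s0 sb bx (lt_trans s0 sb).
  by move=> [/andP[b0 bx] /andP[s0 sb]]; rewrite s0 sb bx.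
- move=> b s; rewrite /E/= !in_itv/=; split.
    by move=> /andP[/andP[s0 sb] bx]; rewrite s0 sb bx (lt_trans sb bx).
  by move=> [/andP[s0 sx] /andP[sb bx]]; rewrite s0 sb bx.
rewrite /J -ge0_integralZl//; last 3 first.
  - exact: measurable_moment_integrand.
  - by move=> s _; rewrite lee_fin mulr_ge0// powR_ge0.
  - by rewrite lee_fin powR_ge0.
have inner (s : R) : s \in `]0%R, x[%classic -> (\int[leb]_(b in `]s, x[) F (b, s) =
    ((s `^ (- k) - x `^ (- k)) * (s `^ (1 + k) * f s))%:E)%E.
  rewrite inE/= in_itv/= => /andP[s0 sx].
  under eq_integral => b _ do rewrite /F/= mulrC EFinM.
  rewrite ge0_integralZl//; last 3 first.
  - by apply/measurable_EFinP; apply: measurable_funM => //; exact: measurable_funTS.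
  - by move=> b _; rewrite lee_fin mulr_ge0 ?powR_ge0// ltW.
  - by rewrite lee_fin mulr_ge0// powR_ge0.
  under eq_integral => b _ do rewrite EFinM.
  rewrite ge0_integralZl//; last 3 first.
  - exact: measurable_powR_EFin.
  - by move=> b _; rewrite lee_fin powR_ge0.
  - by rewrite lee_fin ltW.
  rewrite (_ : - (1 + k) = - k - 1); last by ring.
  rewrite integral_powR_itv// ?ltW// ?oppr_eq0 ?gt_eqF//.
  rewrite -!EFinM; congr EFin; field; exact: lt0r_neq0.
transitivity (\int[leb]_(s in `]0%R, x[)
    ((s `^ (- k) - x `^ (- k)) * (s `^ (1 + k) * f s))%:E +
    \int[leb]_(s in `]0%R, x[) ((x `^ (- k))%:E * (s `^ (1 + k) * f s)%:E))%E.
  by congr (_ + _)%E; apply: eq_integral => s; exact: inner.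
rewrite -ge0_integralD//; last 4 first.
- move=> s; rewrite /= in_itv/= => /andP[s0 sx].
  rewrite lee_fin mulr_ge0// ?mulr_ge0 ?powR_ge0// subr_ge0.
  by rewrite !powRN lef_pV2 ?posrE ?powR_gt0// ge0_ler_powR ?nnegrE// ltW.
- apply/measurable_EFinP; apply: measurable_funM; last first.
    by apply/measurable_EFinP; exact: measurable_moment_integrand.
  by apply: measurable_funB => //; exact: measurable_funTS.
- by move=> s _; rewrite lee_fin !mulr_ge0// powR_ge0.
- apply/measurable_EFinP; apply: measurable_funM => //.
  by apply/measurable_EFinP; exact: measurable_moment_integrand.
apply: eq_integral => s; rewrite inE/= in_itv/= => /andP[s0 _].
rewrite -EFinD; congr EFin.
rewrite -mulrDl subrK mulrA -powRD; last by rewrite (gt_eqF s0) implybT.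
by rewrite (_ : - k + (1 + k) = 1) ?powRr1// ?ltW//; ring.
Qed.

(** The pointwise part of condition (I) multiplied by [b]: it is the nonnegativity of [g] on (0,
    1). *)
Definition kernel_condition :=
  forall b : R, 0 < b < 1 -> k * b `^ (- (1 + k)) * Jr b <= b * f b.
Hypothesis kc : kernel_condition.

Lemma second_density_ge0 b : 0 < b < 1 -> 0 <= g b.
Proof. by move=> b01; rewrite subr_ge0 kc. Qed.

(** The fundamental theorem of calculus for [b ^ (- k) * J b], derived from the exchange of
    integrals because [f] need not be continuous. *)
Lemma integral_second_density x : 0 < x -> x <= 1 ->
  (\int[leb]_(b in `]0%R, x[) (g b)%:E = (x `^ (- k))%:E * J x)%E.
Proof.
move=> x0 x1.
have := integral_moment_kernel x0 x1.
set H := (\int[leb]_(b in _) _)%E.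
set S := (\int[leb]_(s in _) _)%E => HS.
have H0 : (0 <= H)%E.
  apply: integral_ge0 => b _; rewrite lee_fin; exact: moment_kernel_ge0.
have SE : (\int[leb]_(b in `]0%R, x[) (g b)%:E + H = S)%E.
  rewrite -ge0_integralD//.
  - by apply: eq_integral => b _; rewrite -EFinD subrK.
  - move=> b; rewrite /= in_itv/= => /andP[b0 bx].
    by rewrite lee_fin second_density_ge0// b0 (lt_le_trans bx).
  - by apply/measurable_EFinP; apply: measurable_funS measurable_second_density.
  - move=> b _; rewrite lee_fin; exact: moment_kernel_ge0.
  - apply/measurable_EFinP; apply: measurable_funM; last exact: measurable_truncated_moment.
    by apply: measurable_funM => //; exact: measurable_funTS.
have Sfin : (S < +oo)%E.
  apply: le_lt_trans (ltry 1); apply: le_trans f_le1.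
  apply: (@le_trans _ _ (\int[leb]_(s in `]0%R, x[) (f s)%:E)%E).
    apply: ge0_le_integral => //.
    - by move=> s; rewrite /= in_itv/= => /andP[s0 sx]; rewrite lee_fin mulr_ge0// ltW.
    - apply/measurable_EFinP; apply: measurable_funM => //.
      exact: measurable_funS mf.
    - by apply/measurable_EFinP; exact: measurable_funS mf.
    - move=> s; rewrite /= in_itv/= => /andP[s0 sx]; rewrite lee_fin ler_piMl//.
      by rewrite ltW// (lt_le_trans sx).
  apply: ge0_subset_integral => //; first exact/measurable_EFinP.
  by move=> s _; rewrite lee_fin.
(* Cancelling [H] requires its finiteness. As [g] is nonnegative, [H] is at most [S], which is at
   most the mass of [f]. *)
have Hfin : H \is a fin_num.
  rewrite ge0_fin_numE//; apply: le_lt_trans Sfin; rewrite -SE leeDr//.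
  apply: integral_ge0 => b; rewrite /= in_itv/= => /andP[b0 bx].
  by rewrite lee_fin second_density_ge0// b0 (lt_le_trans bx).
by rewrite -[LHS](addeK _ Hfin) SE -HS (addeC H) addeK.
Qed.

(* Integral against the part of the adversarial distribution off the diagonal in
   which a given bidder is on top, with value z.1, and the others have value z.2. *)
Definition fiber_integral (W : R * R -> \bar R) : \bar R :=
  (\int[leb]_(a in `]0%R, 1%R[) \int[leb]_(b in `]0%R, a])
     (W (a, b) * (k * (a ^+ 2)^-1)%:E * (g b)%:E)
   + \int[leb]_(b in `]0%R, 1%R[) (W (1%R, b) * k%:E * (g b)%:E))%E.

Let triangle : set (R * R) := [set z | (0 < z.2) && (z.2 <= z.1) && (z.1 < 1)].

Let measurable_triangle : measurable triangle.
Proof.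
apply: measurable_pred; apply: measurable_and; last by apply: measurable_fun_ltr.
by apply: measurable_and; [apply: measurable_fun_ltr | apply: measurable_fun_ler].
Qed.

Let triangle_slice1 a b :
  triangle (a, b) <-> `]0%R, 1%R[%classic a /\ `]0%R, a]%classic b.
Proof.
rewrite /triangle/= !in_itv/=; split.
  by move=> /andP[/andP[b0 ba] a1]; rewrite b0 ba a1 (lt_le_trans b0 ba).
by move=> [/andP[a0 a1] /andP[b0 ba]]; rewrite b0 ba a1.
Qed.

Let triangle_slice2 a b :
  triangle (a, b) <-> `]0%R, 1%R[%classic b /\ `[b, 1%R[%classic a.
Proof.
rewrite /triangle/= !in_itv/=; split.
  by move=> /andP[/andP[b0 ba] a1]; rewrite b0 ba a1 (le_lt_trans ba a1).
by move=> [/andP[b0 b1] /andP[ba a1]]; rewrite b0 ba a1.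
Qed.

Let triangle01 z : triangle z -> 0 < z.1 < 1 /\ 0 < z.2 < 1.
Proof.
case: z => a b /= /andP[/andP[b0 ba] a1].
by rewrite (lt_le_trans b0 ba) a1 b0 (le_lt_trans ba a1).
Qed.

Let fiber_density (z : R * R) : R := k * (z.1 ^+ 2)^-1 * g z.2.

Let measurable_fiber_density : measurable_fun setT fiber_density.
Proof.
apply: measurable_funM; last exact: (measurableT_comp measurable_second_density).
apply: measurable_funM => //.
exact: (measurableT_comp (@measurable_invr_sqr R setT) measurable_fst).
Qed.

Let fiber_density_ge0 z : triangle z -> 0 <= fiber_density z.
Proof.
move=> /triangle01[_ z2].
by rewrite !mulr_ge0 ?invr_ge0 ?sqr_ge0 ?second_density_ge0// ltW.
Qed.

Lemma representable_fiber d (T : measurableType d) (phi : R * R -> T) :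
  measurable_fun setT phi ->
  representable (fun w : T -> \bar R => fiber_integral (w \o phi)).
Proof.
move=> mphi.
have mphi1 : measurable_fun setT (fun b : R => phi (1, b)).
  by apply: (measurableT_comp mphi); exact: measurable_fun_pair.
(* [g] may be negative outside (0, 1), whereas a density must be nonnegative everywhere; hence the
   restrictions. *)
have md1 : measurable_fun setT (fiber_density \_ triangle).
  apply: ((measurable_restrictT _ measurable_triangle).1 _).
  exact: measurable_funTS measurable_fiber_density.
have md2 : measurable_fun setT ((fun b => k * g b) \_ `]0%R, 1%R[).
  apply: ((measurable_restrictT _ _).1 _) => //; apply: measurable_funTS.
  by apply: measurable_funM => //; exact: measurable_second_density.
have d10 z : 0 <= (fiber_density \_ triangle) z.
  by rewrite patchE; case: ifPn => // /set_mem; exact: fiber_density_ge0.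
have d20 b : 0 <= ((fun b => k * g b) \_ `]0%R, 1%R[) b.
  rewrite patchE; case: ifPn => // /set_mem; rewrite /= in_itv/= => b01.
  by rewrite mulr_ge0 ?second_density_ge0// ltW.
apply: representable_ext (representable_add
  (representable_density_pushforward (leb \x leb)%E mphi md1 d10)
  (representable_density_pushforward leb mphi1 md2 d20)) => w mw w0.
rewrite /fiber_integral; congr (_ + _)%E.
  pose F z : \bar R := (w (phi z) * (k * (z.1 ^+ 2)^-1)%:E * (g z.2)%:E)%E.
  transitivity (\int[leb \x leb]_(z in triangle) F z)%E.
    rewrite [RHS]integral_mkcond; apply: eq_integral => z _.
    rewrite !patchE; case: ifPn => _; last by rewrite mul0e.
    by rewrite /F /fiber_density EFinM -[RHS]muleA [RHS]muleC.
  have FE : F = (fun z => w (phi z) * (fiber_density z)%:E)%E.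
    by apply/funext => z; rewrite /F -muleA -EFinM.
  apply: (tonelli_slices1 leb leb measurable_triangle _ _ triangle_slice1).
    rewrite FE; apply: measurable_funTS; apply: emeasurable_funM.
      exact: measurableT_comp mw mphi.
    exact/measurable_EFinP.
  by move=> z tz; rewrite FE mule_ge0// lee_fin fiber_density_ge0.
rewrite [RHS]integral_mkcond; apply: eq_integral => b _.
rewrite !patchE; case: ifPn => _; last by rewrite mul0e.
by rewrite EFinM -[RHS]muleA [RHS]muleC.
Qed.

(** For fixed [b] both parts carry the factor [k * g b]. Taking it out exposes the fibre measure:
    [da / a^2] below 1 and a unit atom at 1. *)
Lemma fiber_integral_swap (W : R * R -> \bar R) :
  measurable_fun setT W -> (forall z, 0 <= W z)%E ->
  fiber_integral W =
  (\int[leb]_(b in `]0%R, 1%R[) ((k * g b)%:E *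
     (\int[leb]_(a in `[b, 1%R[) (W (a, b) * ((a ^+ 2)^-1)%:E) + W (1%R, b))))%E.
Proof.
move=> mW W0; pose F z : \bar R := (W z * (k * (z.1 ^+ 2)^-1)%:E * (g z.2)%:E)%E.
have FE : F = (fun z => W z * (fiber_density z)%:E)%E.
  by apply/funext => z; rewrite /F -muleA -EFinM.
have mF : measurable_fun triangle F.
  rewrite FE; apply: measurable_funTS; apply: emeasurable_funM => //.
  exact/measurable_EFinP.
have F0 z : triangle z -> (0 <= F z)%E.
  by move=> tz; rewrite FE mule_ge0// lee_fin fiber_density_ge0.
have mWb b : measurable_fun setT (fun a => W (a, b)).
  exact: (measurableT_comp mW (pair2_measurable b)).
have mW1 : measurable_fun setT (fun b : R => W (1, b)).
  exact: (measurableT_comp mW (pair1_measurable (1 : R))).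
have msq (D : set R) : measurable_fun D (fun a : R => ((a ^+ 2)^-1)%:E).
  by apply/measurable_EFinP; exact: measurable_invr_sqr.
have kg0 b : b \in `]0%R, 1%R[%classic -> (0 <= (k * g b)%:E)%E.
  rewrite inE/= in_itv/= => b01.
  by rewrite lee_fin mulr_ge0 ?second_density_ge0// ltW.
have inner b : b \in `]0%R, 1%R[%classic ->
    (\int[leb]_(a in `[b, 1%R[) F (a, b) =
     (k * g b)%:E * \int[leb]_(a in `[b, 1%R[) (W (a, b) * ((a ^+ 2)^-1)%:E))%E.
  move=> b01; rewrite -ge0_integralZl//.
  - apply: eq_integral => a _; rewrite /F/= EFinM [in RHS]EFinM.
    by rewrite [RHS]muleC muleACA !muleA.
  - apply: emeasurable_funM; [exact: (measurable_funTS (mWb b)) | exact: msq].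
  - by move=> a _; rewrite mule_ge0// lee_fin invr_ge0 sqr_ge0.
  - exact: kg0.
rewrite /fiber_integral.
rewrite (@lebesgue_tonelli R triangle F `]0%R, 1%R[ `]0%R, 1%R[
  (fun a => `]0%R, a]%classic) (fun b => `[b, 1%R[%classic))//.
rewrite -ge0_integralD//; last 4 first.
- move=> b; rewrite /= in_itv/= => /andP[b0 b1]; apply: integral_ge0 => a.
  rewrite /= in_itv/= => /andP[ba a1]; apply: F0.
  by rewrite /triangle/= b0 ba a1.
- exact: (measurable_slice_integral2 leb measurable_triangle mF F0 triangle_slice2).
- by move=> b b01; rewrite -muleA mule_ge0// -EFinM kg0// inE.
- apply: emeasurable_funM; last first.
    apply/measurable_EFinP; exact: (measurable_funTS measurable_second_density).
  by apply: emeasurable_funM => //; apply: measurable_funTS; exact: mW1.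
apply: eq_integral => b b01; rewrite inner//.
rewrite -muleA -EFinM (muleC (W _)) -ge0_muleDr//.
apply: integral_ge0 => a _; by rewrite mule_ge0// lee_fin invr_ge0 sqr_ge0.
Qed.

Let measurable_kg (D : set R) : measurable_fun D (fun b => (k * g b)%:E).
Proof.
apply/measurable_EFinP; apply: measurable_funM => //.
exact: measurable_funS measurable_second_density.
Qed.

Let kg_ge0 b : 0 < b < 1 -> 0 <= k * g b.
Proof. by move=> b01; rewrite mulr_ge0 ?second_density_ge0// ltW. Qed.

(** The fibre over [b] has mass [(1 / b - 1) + 1 = 1 / b]. *)
Lemma fiber_integral_snd (psi : R -> \bar R) :
  measurable_fun setT psi -> (forall x, 0 <= psi x)%E ->
  fiber_integral (psi \o snd) =
  (\int[leb]_(b in `]0%R, 1%R[) ((k * g b / b)%:E * psi b))%E.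
Proof.
move=> mpsi psi0; rewrite fiber_integral_swap; last 2 first.
- exact: (measurableT_comp mpsi measurable_snd).
- by move=> z; exact: psi0.
apply: eq_integral => b; rewrite inE/= in_itv/= => /andP[b0 b1].
rewrite ge0_integralZl//; last 2 first.
- by apply/measurable_EFinP; exact: measurable_invr_sqr.
- by move=> a _; rewrite lee_fin invr_ge0 sqr_ge0.
rewrite integral_inv_sqr_itv ?(ltW b1)// invr1.
rewrite -[X in (_ + X)%E]mule1 -ge0_muleDr//; last first.
  by rewrite lee_fin subr_ge0 invf_ge1// ltW.
by rewrite -EFinD subrK [in RHS]EFinM -[RHS]muleA (muleC (psi b)).
Qed.

(** For fixed top value [a] the density of the other value integrates to [a ^ (- k) * J a]. *)
Lemma fiber_integral_fst (psi : R -> \bar R) :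
  measurable_fun setT psi -> (forall x, 0 <= psi x)%E ->
  fiber_integral (psi \o fst) =
  (\int[leb]_(a in `]0%R, 1%R[)
     ((k * (a ^+ 2)^-1 * (a `^ (- k) * Jr a))%:E * psi a)
   + (k * Jr 1)%:E * psi 1%R)%E.
Proof.
move=> mpsi psi0; rewrite /fiber_integral; congr (_ + _)%E.
  apply: eq_integral => a; rewrite inE/= in_itv/= => /andP[a0 a1].
  rewrite ge0_integralZl//; last 3 first.
  - apply/measurable_EFinP; exact: measurable_funS measurable_second_density.
  - move=> b; rewrite /= in_itv/= => /andP[b0 ba].
    by rewrite lee_fin second_density_ge0// b0 (le_lt_trans ba).
  - by rewrite mule_ge0// lee_fin mulr_ge0 ?invr_ge0 ?sqr_ge0// ltW.
  rewrite -integral_itv_bndo_bndc; last first.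
    by apply/measurable_EFinP; exact: measurable_funS measurable_second_density.
  rewrite integral_second_density ?ltW// -truncated_moment_fineK -EFinM.
  by rewrite -muleA -EFinM muleC.
rewrite /= ge0_integralZl//; last 3 first.
- apply/measurable_EFinP; exact: measurable_funS measurable_second_density.
- by move=> b; rewrite /= in_itv/= => b01; rewrite lee_fin second_density_ge0.
- by rewrite mule_ge0// lee_fin ltW.
rewrite integral_second_density// powR1 mul1e -truncated_moment_fineK.
by rewrite -muleA -EFinM muleC.
Qed.

(* The two densities add up to f because g b / b is f b minus the contribution
   of the profiles in which the bidder holds the highest value b. *)
Lemma fiber_integral_marginal (n : R) (psi : R -> \bar R) : n * k = 1 -> 0 <= n ->
  measurable_fun setT psi -> (forall x, 0 <= psi x)%E ->
  (fiber_integral (psi \o fst) + n%:E * fiber_integral (psi \o snd) =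
   \int[leb]_(b in `]0%R, 1%R[) ((f b)%:E * psi b) + (k * Jr 1)%:E * psi 1%R)%E.
Proof.
move=> nk n0 mpsi psi0; rewrite fiber_integral_fst// fiber_integral_snd//.
rewrite addeAC; congr (_ + _)%E.
have mpsi' (D : set R) : measurable_fun D psi by exact: measurable_funTS.
have m1 (D : set R) : measurable_fun D
    (fun b => ((k * g b / b)%:E * psi b)%E).
  apply: emeasurable_funM; [apply/measurable_EFinP|exact: mpsi'].
  apply: measurable_funM; last exact: measurable_invr.
  by apply/measurable_EFinP; exact: measurable_kg.
have gb0 b : 0 < b < 1 -> 0 <= k * g b / b.
  by move=> /[dup] /andP[b0 _] b01; rewrite divr_ge0 ?kg_ge0// ltW.
rewrite -ge0_integralZl//; last 2 first.
- exact: m1.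
- by move=> b; rewrite /= in_itv/= => b01; rewrite mule_ge0// lee_fin gb0.
rewrite -ge0_integralD//; last 4 first.
- move=> a _; rewrite mule_ge0// lee_fin mulr_ge0 ?mulr_ge0 ?invr_ge0 ?sqr_ge0 ?powR_ge0 ?fine_truncated_moment_ge0//.
  exact: ltW.
- apply: emeasurable_funM; [apply/measurable_EFinP|exact: mpsi'].
  apply: measurable_funM; last first.
    apply: measurable_funM; last exact: measurable_truncated_moment.
    exact: measurable_funTS.
  by apply: measurable_funM => //; exact: measurable_invr_sqr.
- move=> b; rewrite /= in_itv/= => b01; rewrite mule_ge0 ?lee_fin//.
  by rewrite mule_ge0// lee_fin gb0.
- by apply: emeasurable_funM => //; exact: m1.
apply: eq_integral => b; rewrite inE/= in_itv/= => /andP[b0 b1].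
rewrite muleA -EFinM -ge0_muleDl; last 2 first.
- rewrite lee_fin mulr_ge0 ?mulr_ge0 ?invr_ge0 ?sqr_ge0 ?powR_ge0 ?fine_truncated_moment_ge0//.
  exact: ltW.
- by rewrite lee_fin mulr_ge0 ?gb0 ?b0.
congr (_ * _)%E; rewrite -EFinD; congr EFin.
have b_neq0 : b != 0 by rewrite gt_eqF.
have E : b `^ (- (1 + k)) = b^-1 * b `^ (- k).
  by rewrite opprD powRD ?powR_inv1 ?ltW// b_neq0 implybT.
rewrite /second_density E !mulrA nk mul1r.
by field.
Qed.

Let measurable_fiber_inner (W : R * R -> \bar R) :
  measurable_fun setT W -> (forall z, 0 <= W z)%E ->
  measurable_fun (`]0%R, 1%R[ : set R) (fun b =>
    \int[leb]_(a in `[b, 1%R[) (W (a, b) * ((a ^+ 2)^-1)%:E) + W (1%R, b))%E.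
Proof.
move=> mW W0.
have mW1 : measurable_fun setT (fun b : R => W (1, b)).
  exact: (measurableT_comp mW (pair1_measurable (1 : R))).
apply: emeasurable_funD; last by apply: measurable_funTS; exact: mW1.
pose F (z : R * R) : \bar R := (W z * ((z.1 ^+ 2)^-1)%:E)%E.
have mF : measurable_fun triangle F.
  apply: measurable_funTS; apply: emeasurable_funM => //; apply/measurable_EFinP.
  exact: (measurableT_comp (@measurable_invr_sqr R setT) measurable_fst).
have F0 z : triangle z -> (0 <= F z)%E.
  by move=> _; rewrite mule_ge0// lee_fin invr_ge0 sqr_ge0.
exact: (measurable_slice_integral2 leb measurable_triangle mF F0 triangle_slice2).
Qed.

(** Read [W] as the shortfall of revenue from 1. The hypothesis compares it with the fibre mass
    [1 / b] minus 1, so each fibre yields at most 1; weighting by [k * g b] turns this into at most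
    [k * J 1] in all. *)
Lemma fiber_integral_ge (W : R * R -> \bar R) :
  measurable_fun setT W -> (forall z, 0 <= W z)%E ->
  (forall b, 0 < b < 1 -> ((b^-1 - 1)%:E <=
     \int[leb]_(a in `[b, 1%R[) (W (a, b) * ((a ^+ 2)^-1)%:E) + W (1%R, b))%E) ->
  (fiber_integral (cst 1%E) <= fiber_integral W + (k * Jr 1)%:E)%E.
Proof.
move=> mW W0 Wb.
have -> : fiber_integral (cst 1%E) = fiber_integral (cst 1%E \o snd) by [].
rewrite fiber_integral_snd//.
have inv1 (b : R) : 0 < b < 1 -> 0 <= b^-1 - 1.
  by move=> /andP[b0 b1]; rewrite subr_ge0 invf_ge1// ltW.
have m1 (D : set R) : measurable_fun D (fun b => (b^-1 - 1)%:E).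
  by apply/measurable_EFinP; apply: measurable_funB => //; exact: measurable_invr.
apply: (@le_trans _ _ (\int[leb]_(b in `]0%R, 1%R[) ((k * g b)%:E * (b^-1 - 1)%:E)
    + (k * Jr 1)%:E)%E).
  (* The factor [x ^ (- k)] in the integral of [g] is 1 at [x = 1]. *)
  rewrite (_ : (k * Jr 1)%:E = \int[leb]_(b in `]0%R, 1%R[) (k * g b)%:E)%E; last first.
    under eq_integral do rewrite EFinM.
    rewrite ge0_integralZl//; last 3 first.
    - apply/measurable_EFinP; exact: measurable_funS measurable_second_density.
    - by move=> b; rewrite /= in_itv/= => b01; rewrite lee_fin second_density_ge0.
    - by rewrite lee_fin ltW.
    by rewrite integral_second_density// powR1 mul1e -truncated_moment_fineK -EFinM.
  rewrite -ge0_integralD//; last 3 first.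
  - move=> b; rewrite /= in_itv/= => b01.
    by rewrite -EFinM lee_fin mulr_ge0 ?kg_ge0 ?inv1.
  - by apply: emeasurable_funM; [exact: measurable_kg|exact: m1].
  - exact: measurable_kg.
  rewrite le_eqVlt; apply/orP; left; apply/eqP; apply: eq_integral => b _.
  by rewrite mule1 -EFinM -EFinD; congr EFin; ring.
rewrite leeD2r// fiber_integral_swap//; apply: ge0_le_integral => //.
- move=> b; rewrite /= in_itv/= => b01.
  by rewrite -EFinM lee_fin mulr_ge0 ?kg_ge0 ?inv1.
- by apply: emeasurable_funM; [exact: measurable_kg|exact: m1].
- by apply: emeasurable_funM; [exact: measurable_kg|exact: measurable_fiber_inner].
- move=> b; rewrite /= in_itv/= => b01.
  by rewrite lee_wpmul2l ?lee_fin ?kg_ge0// Wb.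
Qed.

End correlation_density.

(** * The revenue bound on one fibre *)

Section mechanism_bound.
Context {R : realType}.
Local Notation leb := (@lebesgue_measure R).
Variables (q tau W : R -> R) (b : R).
Hypothesis b01 : 0 < b < 1.
Hypothesis ic : forall x y, 0 <= x <= 1 -> 0 <= y <= 1 ->
  y * q x - tau x <= y * q y - tau y.
Hypothesis ir : forall x, 0 <= x <= 1 -> 0 <= x * q x - tau x.
Hypothesis q_le1 : forall x, 0 <= x <= 1 -> q x <= 1.
Hypotheses (mW : measurable_fun setT W) (W_ge0 : forall a, 0 <= W a).
Hypothesis W_ge : forall a, b < a <= 1 -> 1 - tau a <= W a.

Let I x y : \bar R := (\int[leb]_(a in `]x, y]) (W a * (a ^+ 2)^-1)%:E)%E.

Let mI (D : set R) : measurable_fun D (fun a => (W a * (a ^+ 2)^-1)%:E).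
Proof.
apply/measurable_EFinP; apply: measurable_funM; last exact: measurable_invr_sqr.
exact: measurable_funTS mW.
Qed.

Let I_ge0 a : 0 <= W a * (a ^+ 2)^-1.
Proof. by rewrite mulr_ge0 ?invr_ge0 ?sqr_ge0. Qed.

Let b0 : 0 < b. Proof. by case/andP: b01. Qed.

(** The two incentive constraints make [q] nondecreasing, and the payment increases by at least
    [x * (q y - q x)]. This monotonicity is the regularity that the Riemann sums rely on. *)
Let tau_mono x y : 0 <= x -> x <= y -> y <= 1 -> tau x <= tau y.
Proof.
move=> x0; rewrite le_eqVlt => /predU1P[->//|xy] y1.
have x01 : 0 <= x <= 1 by rewrite x0 (le_trans (ltW xy)).
have y01 : 0 <= y <= 1 by rewrite y1 (le_trans x0 (ltW xy)).
have := ic x01 y01; have := ic y01 x01 => h1 h2.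
have : q x <= q y by rewrite -(ler_pM2l (_ : 0 < y - x)) ?subr_gt0//; lra.
by move=> /(ler_wpM2l x0); lra.
Qed.

(** Indirect utility per unit of value; formally its derivative is [tau x / x^2]. *)
Let phi x := (x * q x - tau x) / x.

(** The difference-quotient form of that derivative. What is left over is the loss of type [y] from
    reporting [x], divided by [y]. *)
Let phi_incr x y : 0 < x -> x <= y -> y <= 1 ->
  tau x * (x^-1 - y^-1) <= phi y - phi x.
Proof.
move=> x0 xy y1; have y0 := lt_le_trans x0 xy.
have := @ic x y; rewrite (ltW x0) (ltW y0) y1 (le_trans xy y1) => /(_ isT isT) h.
have -> : phi y - phi x = (y * q y - tau y - (y * q x - tau x)) / y
    + tau x * (x^-1 - y^-1).
  by rewrite /phi; field; rewrite !gt_eqF.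
by rewrite lerDr divr_ge0 ?subr_ge0// ltW.
Qed.

Let I_split x m y : x <= m -> m <= y -> (I x m + I m y = I x y)%E.
Proof.
move=> xm my; rewrite /I.
have -> : `]x, y]%classic = `]x, m]%classic `|` `]m, y]%classic.
  by rewrite -itv_bndbnd_setU ?bnd_simp.
rewrite ge0_integral_setU//.
- exact: mI.
- by move=> a _; rewrite lee_fin.
- by apply/disj_setPS => a [] /=; rewrite !in_itv/= => /andP[_ am] /andP[ma _]; move: (lt_le_trans ma am); rewrite ltxx.
Qed.

(* Each halving of [x, y] halves the error of the monotone Riemann bound. *)
Let I_approx n x y : b <= x -> x <= y -> y <= 1 ->
  (((x^-1 - y^-1) - (phi y - phi x)
    - (tau y - tau x) * (y - x) / (b ^+ 2 * 2 ^+ n))%:E <= I x y)%E.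
Proof.
elim: n x y => [|n IH] x y bx xy y1; have x0 := lt_le_trans b0 bx;
  have y0 := lt_le_trans x0 xy.
  have tauy1 : 0 <= 1 - tau y.
    have y01 : 0 <= y <= 1 by rewrite ltW.
    have := ir y01; have := ler_wpM2l (ltW y0) (q_le1 y01); lra.
  (* On []x, y]] the integrand is at least [(1 - tau y) / a^2] by monotonicity, while [phi_incr]
     controls [tau x]. Passing from one payment to the other costs at most
     [(tau y - tau x) * (y - x) / b^2]. *)
  apply: (@le_trans _ _ ((1 - tau y) * (x^-1 - y^-1))%:E).
    rewrite lee_fin expr0 mulr1.
    have h1 := phi_incr x0 xy y1.
    have h2 : (tau y - tau x) * (x^-1 - y^-1) <= (tau y - tau x) * (y - x) / b ^+ 2.
      rewrite -mulrA ler_wpM2l ?subr_ge0 ?tau_mono ?(ltW x0)//.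
      have -> : x^-1 - y^-1 = (y - x) / (x * y) by field; rewrite !gt_eqF.
      rewrite ler_wpM2l ?subr_ge0// lef_pV2 ?posrE ?exprn_gt0 ?mulr_gt0//.
      by rewrite expr2 ler_pM ?(ltW b0)// (le_trans bx).
    lra.
  rewrite EFinM -(@integral_inv_sqr_itv _ _ _ false false)// -ge0_integralZl//; last 2 first.
  - by apply/measurable_EFinP; exact: measurable_invr_sqr.
  - by move=> a _; rewrite lee_fin invr_ge0 sqr_ge0.
  apply: ge0_le_integral => //.
  - by move=> a _; rewrite -EFinM lee_fin mulr_ge0 ?invr_ge0 ?sqr_ge0.
  - apply: emeasurable_funM => //; apply/measurable_EFinP; exact: measurable_invr_sqr.
  - exact: mI.
  - move=> a; rewrite /= in_itv/= => /andP[xa ay].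
    rewrite -EFinM lee_fin ler_wpM2r ?invr_ge0 ?sqr_ge0//.
    apply: le_trans (W_ge _); last by rewrite (le_lt_trans bx xa) (le_trans ay).
    by rewrite lerD2l lerN2 tau_mono// ltW// (lt_trans x0).
pose m := (x + y) / 2.
have xm : x <= m by rewrite /m; lra.
have my : m <= y by rewrite /m; lra.
rewrite -(I_split xm my); apply: le_trans (leeD (IH x m bx xm _) (IH m y _ my y1)).
- rewrite -EFinD lee_fin.
  have -> : m - x = (y - x) / 2 by rewrite /m; field.
  have -> : y - m = (y - x) / 2 by rewrite /m; field.
  rewrite (exprS 2 n) (_ : b ^+ 2 * (2 * 2 ^+ n) = 2 * (b ^+ 2 * 2 ^+ n)); last by ring.
  have : b ^+ 2 * 2 ^+ n != 0 by rewrite mulf_neq0// expf_neq0// gt_eqF.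
  move: (b ^+ 2 * 2 ^+ n) => D D0.
  rewrite le_eqVlt; apply/orP; left; apply/eqP.
  move: (phi x) (phi m) (phi y) (tau x) (tau m) (tau y) (x^-1) (m^-1) (y^-1) => *.
  by field.
- exact: le_trans my y1.
- exact: le_trans bx xm.
Qed.

(** The fibre has mass [1 / b], so the claim is that at most 1 is collected on it. The measurable
    majorant [W] of [1 - tau] carries the integral because [q] and [tau] are arbitrary functions. *)
Lemma mechanism_bound :
  ((b^-1 - 1)%:E <= \int[leb]_(a in `[b, 1%R[) ((W a)%:E * ((a ^+ 2)^-1)%:E)
     + (W 1)%:E)%E.
Proof.
have b1 : b < 1 by case/andP: b01.
(* The endpoint [b] is discarded as a null set: there all bidders tie, and [W_ge] gives nothing. *)
rewrite integral_itv_bndoo; last exact: mI.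
have -> : (\int[leb]_(a in `]b, 1%R[) ((W a)%:E * ((a ^+ 2)^-1)%:E) = I b 1%R)%E.
  rewrite /I [RHS]integral_itv_bndoo; last exact: mI.
  by apply: eq_integral => a _; rewrite EFinM.
have lim : ((b^-1 - 1 - (phi 1 - phi b))%:E <= I b 1%R)%E.
  apply/lee_addgt0Pr => e e0.
  pose C := (tau 1 - tau b) * (1 - b) / b ^+ 2.
  have [n nC] : exists n, C / 2 ^+ n <= e.
    have C0 : 0 <= C.
      by rewrite divr_ge0 ?mulr_ge0 ?subr_ge0 ?tau_mono ?sqr_ge0// ltW.
    exists (Num.bound (C / e)).
    have h : C / e < 2 ^+ Num.bound (C / e).
      apply: lt_trans (archi_boundP (divr_ge0 C0 (ltW e0))) _.
      by rewrite -natrX ltr_nat ltn_expl.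
    rewrite ler_pdivrMr ?exprn_gt0// mulrC -ler_pdivrMr// ltW//.
  apply: le_trans (leeD2r e%:E (I_approx n (lexx b) (ltW b1) (lexx 1))).
  rewrite -EFinD lee_fin invr1.
  have -> : (tau 1 - tau b) * (1 - b) / (b ^+ 2 * 2 ^+ n) = C / 2 ^+ n.
    by rewrite /C invfM !mulrA.
  lra.
have phib : 0 <= phi b.
  by rewrite /phi divr_ge0 ?ir ?(ltW b0) ?(ltW b1).
have W1 : 1 - tau 1 <= W 1 by rewrite W_ge// b1 lexx.
have q1 : q 1 <= 1 by rewrite q_le1// ler01 lexx.
(* The payment at 1 enters [phi 1 = q 1 - tau 1] and the atom [1 - tau 1] with opposite effects and
   cancels, leaving [1 / b - q 1] as a lower bound. *)
apply: le_trans (leeD lim (_ : ((1 - tau 1)%:E <= (W 1)%:E)%E)); last by rewrite lee_fin.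
have phi1 : phi 1 = q 1 - tau 1 by rewrite /phi mul1r divr1.
by rewrite -EFinD lee_fin phi1; lra.
Qed.

End mechanism_bound.

(** * The second price auction with random reserve: incentives and revenue *)

Section second_price.
Context {R : realType} {N : nat}.
Hypothesis N2 : (2 <= N)%N.
Local Notation k := ((N.-1)%:R^-1 : R).
Local Notation p := (pw R N).
Implicit Types (v : profile R N) (i j : 'I_N).

Let N_gt0 : 0 < N%:R :> R. Proof. by rewrite ltr0n (ltn_trans _ N2). Qed.
Let N1_gt0 : 0 < (N.-1)%:R :> R.
Proof. by rewrite ltr0n -ltnS prednK// (ltn_trans _ N2). Qed.

Lemma natr_pred : (N.-1)%:R = N%:R - 1 :> R.
Proof. by rewrite -subn1 natrB// (ltn_trans _ N2). Qed.

Lemma pred_inv_gt0 : 0 < k. Proof. by rewrite invr_gt0. Qed.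

Lemma pwE : p = 1 + k.
Proof.
have := lt0r_neq0 N1_gt0; rewrite /pw natr_pred => h; field; exact: h.
Qed.

Lemma pw_gt0 : 0 < p. Proof. by rewrite divr_gt0. Qed.

Lemma powR_pw (x : R) : 0 <= x -> x * x `^ k = x `^ p.
Proof.
move=> x0; rewrite pwE -{1}(powRr1 x0) -powRD//.
by rewrite gt_eqF// addr_gt0// pred_inv_gt0.
Qed.

Lemma ler_pw (x y : R) : 0 <= x -> x <= y -> x `^ p <= y `^ p.
Proof.
move=> x0 xy; apply: (ge0_ler_powR (ltW pw_gt0)) => //.
by rewrite nnegrE (le_trans x0).
Qed.

(* Young's inequality with the conjugate exponents N / (N - 1) and N. *)
Lemma young_pw (theta x : R) : 0 <= theta -> 0 <= x ->
  theta * x `^ k - N%:R^-1 * x `^ p <= (N.-1)%:R / N%:R * theta `^ p.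
Proof.
move=> t0 x0.
have := @conjugate_powR _ theta (x `^ k) p N%:R t0 (powR_ge0 _ _) pw_gt0 N_gt0.
rewrite -powRrM (_ : k * N%:R = p); last by rewrite mulrC.
rewrite /pw invf_div => h; rewrite lerBlDr (mulrC N%:R^-1) (mulrC (_ / _)).
by apply: h; rewrite natr_pred; field; rewrite gt_eqF.
Qed.

Lemma vmax_others_ge0 v i : 0 <= vmax_others v i.
Proof. exact: bigmax_ge_id. Qed.

Lemma le_vmax_others v i j : j != i -> tnth v j <= vmax_others v i.
Proof. by move=> ji; apply: (le_bigmax_cond _ (tnth v)). Qed.

Lemma vmaxE v i : vmax v = Num.max (tnth v i) (vmax_others v i).
Proof. by rewrite /vmax (bigmaxD1 i). Qed.

Lemma le_vmax v i : tnth v i <= vmax v.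
Proof. by rewrite (vmaxE _ i) le_max lexx. Qed.

Lemma vmax_ge0 v : 0 <= vmax v.
Proof. exact: bigmax_ge_id. Qed.

Lemma ntopE v : ntop v = #|[set i : 'I_N | tnth v i == vmax v]%SET|.
Proof.
apply: eq_card => i; rewrite finset.inE; apply/idP/idP => [/set_mem//|vi].
exact: mem_set.
Qed.

Lemma ntop_gt0 v i : tnth v i = vmax v -> (0 < ntop v)%N.
Proof. by move=> vi; rewrite ntopE; apply/card_gt0P; exists i; rewrite finset.inE vi. Qed.

Lemma ntop1_top v i j : ntop v == 1%N -> tnth v i = vmax v ->
  tnth v j = vmax v -> j = i.
Proof.
rewrite ntopE => /cards1P[l E] vi vj.
have : i \in [set l]%SET by rewrite -E finset.inE vi.
have : j \in [set l]%SET by rewrite -E finset.inE vj.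
by rewrite !finset.inE => /eqP -> /eqP ->.
Qed.

Lemma star_above v i : vmax_others v i < tnth v i ->
  qstar v i = tnth v i `^ k /\
  tstar v i = N%:R^-1 * tnth v i `^ p + (N.-1)%:R / N%:R * vmax_others v i `^ p.
Proof.
move=> mv; have vE : vmax v = tnth v i by rewrite (vmaxE v i) max_l// ltW.
have nt : ntop v = 1%N.
  rewrite ntopE; apply/eqP/cards1P; exists i; apply/setP => j.
  rewrite !finset.inE vE.
  have [->|ji] := eqVneq j i; first by rewrite eqxx.
  by rewrite lt_eqF// (le_lt_trans (le_vmax_others v ji)).
by rewrite /qstar /tstar vE eqxx nt divr1.
Qed.

Lemma star_tie v i : tnth v i = vmax_others v i ->
  exists2 K : R, 1 <= K &
    qstar v i = tnth v i `^ k / K /\ tstar v i = tnth v i `^ p / K.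
Proof.
move=> vm; have vE : vmax v = tnth v i by rewrite (vmaxE v i) -vm maxxx.
exists (ntop v)%:R; first by rewrite ler1n (ntop_gt0 (esym vE)).
(* [ntop v] can be 1 here: the default 0 in [vmax_others] ties with a value 0 above negative
   entries. The two payment formulas then agree. *)
rewrite /qstar /tstar vE eqxx; split=> //; case: ifPn => // /eqP ->.
rewrite -vm divr1 -mulrDl natr_pred -[X in (X + _)]mul1r -mulrDl.
by rewrite [1 + _]addrC subrK divff ?mul1r// gt_eqF.
Qed.

Lemma star_below v i : tnth v i < vmax_others v i ->
  qstar v i = 0 /\ tstar v i = 0.
Proof.
move=> vm; have vE : vmax v = vmax_others v i by rewrite (vmaxE v i) max_r// ltW.
by rewrite /qstar /tstar vE (lt_eqF vm).
Qed.

(** The positive part of the integral from [m] to [theta] of the winning probability [x ^ k]; the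
    constant [(N - 1) / N] is [1 / p]. *)
Definition star_utility (theta m : R) : R :=
  Num.max 0 ((N.-1)%:R / N%:R * (theta `^ p - m `^ p)).

(** A winning report [x] earns [theta * x ^ k - x ^ p / N] minus a term in the other values, and
    Young's inequality bounds this by its value at [x = theta]. *)
Lemma star_utility_ub v i (theta : R) : cube v -> 0 <= theta ->
  theta * qstar v i - tstar v i <= star_utility theta (vmax_others v i).
Proof.
move=> cv t0; have /andP[v0 v1] := cv i.
rewrite /star_utility le_max; have Y := young_pw t0 v0.
have [vm|vm|vm] := ltgtP (tnth v i) (vmax_others v i).
- by have [-> ->] := star_below vm; rewrite mulr0 subrr lexx.
- by have [-> ->] := star_above vm; apply/orP; right; lra.
(* A tie yields the fraction [1 / K] of the payoff of winning outright at that price. If this payoff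
   is positive the fraction only lowers it, and Young's inequality applies with both values
   equal. *)
- have [K K1 [-> ->]] := star_tie vm; rewrite -vm mulrA -mulrBl.
  have K0 : 0 < K by apply: lt_le_trans K1.
  have [h|h] := leP (theta * tnth v i `^ k - tnth v i `^ p) 0.
    by rewrite pmulr_lle0 ?invr_gt0// h.
  apply/orP; right; apply: (@le_trans _ _ (theta * tnth v i `^ k - tnth v i `^ p)).
    by rewrite ler_pdivrMr// ler_peMr// ltW.
  have E : N%:R^-1 * tnth v i `^ p + (N.-1)%:R / N%:R * tnth v i `^ p = tnth v i `^ p.
    by rewrite natr_pred; field; rewrite gt_eqF.
  lra.
Qed.

Lemma star_utility_truth v i : cube v ->
  star_utility (tnth v i) (vmax_others v i) <= tnth v i * qstar v i - tstar v i.
Proof.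
move=> cv; have /andP[v0 v1] := cv i.
have c0 : 0 <= (N.-1)%:R / N%:R :> R by rewrite divr_ge0// ltW.
have P := powR_pw v0; rewrite /star_utility ge_max.
have [vm|vm|vm] := ltgtP (tnth v i) (vmax_others v i).
- have [-> ->] := star_below vm; rewrite mulr0 subrr lexx/=.
  by rewrite mulr_ge0_le0// subr_le0 ler_pw// ltW.
- have [-> ->] := star_above vm; rewrite P.
  have h := ler_pw (vmax_others_ge0 v i) (ltW vm).
  have := mulr_ge0 c0 (_ : 0 <= tnth v i `^ p - vmax_others v i `^ p).
  rewrite subr_ge0 => /(_ h).
  have E : N%:R^-1 * tnth v i `^ p + (N.-1)%:R / N%:R * tnth v i `^ p = tnth v i `^ p.
    by rewrite natr_pred; field; rewrite gt_eqF.
  by move=> h2; apply/andP; split; lra.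
- have [K K1 [-> ->]] := star_tie vm; rewrite -vm mulrA P.
  by rewrite !subrr mulr0 lexx.
Qed.

Lemma tnth_upd v i (x : R) j : tnth (upd v i x) j = if j == i then x else tnth v j.
Proof. by rewrite tnth_mktuple. Qed.

Lemma cube_upd v i (x : R) : cube v -> 0 <= x <= 1 -> cube (upd v i x).
Proof. by move=> cv x01 j; rewrite tnth_upd; case: ifP. Qed.

Lemma vmax_others_upd v i (x : R) : vmax_others (upd v i x) i = vmax_others v i.
Proof. by apply: eq_bigr => j /negbTE ji; rewrite tnth_upd ji. Qed.

(** [star_utility] depends on the true value and the other values only; every report earns at most
    this amount, and truth at least this amount. *)
Lemma star_DSIC : DSIC (@qstar R N) (@tstar R N).
Proof.
move=> i v x /set_mem cv x01; have /andP[v0 _] := cv i.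
apply: le_trans (star_utility_truth i cv).
rewrite -(vmax_others_upd v i x).
by apply: star_utility_ub => //; exact: cube_upd.
Qed.

Lemma star_EPIR : EPIR (@qstar R N) (@tstar R N).
Proof.
move=> i v /set_mem cv; apply: le_trans (star_utility_truth i cv).
by rewrite /star_utility le_max lexx.
Qed.

Lemma star_exclusive : exclusive (@qstar R N).
Proof.
move=> i v _ [j vij]; rewrite /qstar lt_eqF//.
exact: lt_le_trans vij (le_vmax v j).
Qed.

Lemma sum_others i (c : R) : \sum_(j < N | j != i) c = (N.-1)%:R * c.
Proof. by rewrite sumr_const cardC1 card_ord -[LHS]mulr_natl. Qed.

Lemma sum_top v (c : R) :
  \sum_(i < N) (if tnth v i == vmax v then c else 0) = c *+ ntop v.
Proof.
rewrite -big_mkcond sumr_const ntopE; congr (_ *+ _).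
by apply: eq_card => i; rewrite finset.inE.
Qed.

Lemma star_feasible : feasible (@qstar R N).
Proof.
move=> v /set_mem cv.
have vm1 : vmax v `^ k <= 1.
  have one_pow : 1 `^ k = 1 by rewrite powR1.
  rewrite -[leRHS]one_pow.
  apply: (ge0_ler_powR (ltW pred_inv_gt0)); rewrite ?nnegrE ?vmax_ge0//.
  by apply: bigmax_le => // i _; have /andP[] := cv i.
split=> [i|].
  rewrite /qstar; case: ifPn => [/eqP vi|_]; last by rewrite lexx ler01.
  have n1 : 1 <= (ntop v)%:R :> R by rewrite ler1n (ntop_gt0 vi).
  have n0 : 0 < (ntop v)%:R :> R by apply: lt_le_trans n1.
  by rewrite divr_ge0 ?powR_ge0 ?(ltW n0)//= ler_pdivrMr// mul1r (le_trans vm1).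
rewrite sum_top; have [->|n0] := eqVneq (ntop v) 0%N; first by rewrite mulr0n.
by rewrite -[leLHS]mulr_natr divfK// pnatr_eq0.
Qed.

Lemma measurable_bigmax (P : pred 'I_N) :
  measurable_fun setT (fun v : profile R N => \big[Num.max/0]_(i < N | P i) tnth v i).
Proof.
elim: (index_enum _) => [|j s IH].
  rewrite (_ : (fun _ => _) = cst 0) ?measurable_cst//.
  by apply/funext => v; rewrite big_nil.
have [Pj|nPj] := boolP (P j); last first.
  rewrite (_ : (fun _ => _) = (fun v : profile R N =>
    \big[Num.max/0]_(i <- s | P i) tnth v i)) //.
  by apply/funext => v; rewrite big_cons (negbTE nPj).
rewrite (_ : (fun _ => _) = (fun v : profile R N =>
    Num.max (tnth v j) (\big[Num.max/0]_(i <- s | P i) tnth v i))).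
  by apply: measurable_maxr => //; exact: measurable_tnth.
by apply/funext => v; rewrite big_cons Pj.
Qed.

Lemma measurable_star i :
  measurable_fun setT (fun v : profile R N => tstar v i).
Proof.
have mvm : measurable_fun setT (@vmax R N) by exact: (measurable_bigmax predT).
have mvo : measurable_fun setT (fun v : profile R N => vmax_others v i).
  exact: (measurable_bigmax (fun j => j != i)).
have mtop j : measurable_fun setT (fun v : profile R N => tnth v j == vmax v).
  by apply: measurable_fun_eqr => //; exact: measurable_tnth.
have mnt : measurable_fun setT (fun v : profile R N => (ntop v)%:R : R).
  rewrite (_ : (fun _ => _) = (fun v : profile R N => \sum_(j < N)
    (if tnth v j == vmax v then 1 else 0))); last first.
    by apply/funext => v; rewrite sum_top.
  by apply: measurable_sum => j; apply: measurable_fun_ifT.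
apply: measurable_fun_ifT => //; apply: measurable_fun_ifT.
- rewrite (_ : (fun _ => _) = (fun v : profile R N => (ntop v)%:R == 1 :> R)).
    exact: measurable_fun_eqr.
  by apply/funext => v; rewrite -[1]/(1%:R) eqr_nat.
- apply: measurable_funD; apply: measurable_funM => //.
    exact: (measurableT_comp (measurable_powR _)).
  exact: (measurableT_comp (measurable_powR _)).
- apply: measurable_funM; first exact: (measurableT_comp (measurable_powR _)).
  exact: (measurableT_comp (@measurable_invr R setT)).
Qed.

Lemma star_admissible : admissible (@qstar R N) (@tstar R N).
Proof.
split; [exact: star_feasible|exact: star_DSIC|exact: star_EPIR
  |exact: star_exclusive|exact: measurable_star].
Qed.

Lemma sum_tstar v i : tnth v i = vmax v ->
  \sum_(j < N) tstar v j = if ntop v == 1%N then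
    N%:R^-1 * vmax v `^ p + (N.-1)%:R / N%:R * vmax_others v i `^ p
  else vmax v `^ p.
Proof.
move=> vi; case: ifPn => [n1|n1].
  rewrite (bigD1 i)//= big1 => [|j ji].
    by rewrite addr0 /tstar vi eqxx n1.
  rewrite /tstar; case: ifPn => // /eqP vj.
  by rewrite (ntop1_top n1 vi vj) eqxx in ji.
under eq_bigr do rewrite /tstar (negbTE n1).
rewrite sum_top -[LHS]mulr_natr divfK// pnatr_eq0 -lt0n; exact: ntop_gt0 vi.
Qed.

Lemma exists_top v : cube v -> exists i, tnth v i = vmax v.
Proof.
move=> cv; have i0 : 'I_N by exact: Ordinal (ltn_trans (ltnSn 0) N2).
exists (Order.arg_max i0 predT (tnth v)).
by apply/esym; apply: bigmax_eq_arg => // j _; case/andP: (cv j).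
Qed.

Lemma sum_tstar_ge v : cube v ->
  N%:R^-1 * \sum_(i < N) tnth v i `^ p <= \sum_(i < N) tstar v i.
Proof.
move=> cv; have [i vi] := exists_top cv.
have v0 j : 0 <= tnth v j by have /andP[] := cv j.
rewrite (sum_tstar vi); case: ifPn => n1.
  rewrite (bigD1 i)//= mulrDr vi lerD2l [leRHS]mulrAC mulrC.
  rewrite ler_wpM2r ?invr_ge0 ?(ltW N_gt0)//.
  apply: (@le_trans _ _ (\sum_(j < N | j != i) vmax_others v i `^ p)).
    by apply: ler_sum => j ji; rewrite ler_pw// le_vmax_others.
  by rewrite sum_others.
rewrite mulrC ler_pdivrMr//.
apply: (@le_trans _ _ (\sum_(j < N) vmax v `^ p)).
  by apply: ler_sum => j _; rewrite ler_pw// le_vmax.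
by rewrite sumr_const card_ord -[leLHS]mulr_natr.
Qed.

Lemma tnth_prof_top i (a b : R) j :
  tnth (prof_top i a b) j = if j == i then a else b.
Proof. by rewrite tnth_mktuple. Qed.

Lemma prof_top_const i (c : R) : prof_top i c c = prof_const N c.
Proof.
by apply: eq_from_tnth => j; rewrite tnth_prof_top tnth_mktuple if_same.
Qed.

Lemma cube_prof_top i (a b : R) : 0 <= a <= 1 -> 0 <= b <= 1 ->
  cube (prof_top i a b).
Proof. by move=> a01 b01 j; rewrite tnth_prof_top; case: ifP. Qed.

Lemma upd_prof_top i (a b x : R) : upd (prof_top i a b) i x = prof_top i x b.
Proof.
apply: eq_from_tnth => j; rewrite tnth_upd !tnth_prof_top.
by case: (j == i).
Qed.

Lemma sum_tstar_prof_top i (a b : R) : 0 <= b -> b <= a ->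
  \sum_(j < N) tstar (prof_top i a b) j =
  N%:R^-1 * \sum_(j < N) tnth (prof_top i a b) j `^ p.
Proof.
move=> b0 ba; set v := prof_top i a b.
have [j0 j0i] : exists j0 : 'I_N, j0 != i.
  have : (0 < #|predC1 i|)%N by rewrite cardC1 card_ord -ltnS prednK// (ltn_trans _ N2).
  by case/card_gt0P => j; rewrite inE; exists j.
have tv j : tnth v j = if j == i then a else b by exact: tnth_prof_top.
have vo : vmax_others v i = b.
  apply/eqP; rewrite eq_le; apply/andP; split.
    by apply: bigmax_le => // j ji; rewrite tv (negbTE ji).
  by rewrite -[leLHS](_ : tnth v j0 = b) ?le_vmax_others// tv (negbTE j0i).
have vE : vmax v = a by rewrite (vmaxE v i) vo tv eqxx max_l.
have S : \sum_(j < N) tnth v j `^ p = a `^ p + (N.-1)%:R * b `^ p.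
  rewrite (bigD1 i)//= tv eqxx; congr (_ + _).
  rewrite (eq_bigr (fun=> b `^ p)); last by move=> j /negbTE ji; rewrite tv ji.
  by rewrite sum_others.
rewrite S (@sum_tstar _ i) ?vE ?tv ?eqxx// vo; case: ifPn => n1.
  by rewrite mulrDr mulrA (mulrC N%:R^-1 (N.-1)%:R).
(* With [b < a] bidder [i] would be alone on top, so a second top bidder forces the diagonal. *)
have -> : b = a.
  apply/eqP; rewrite eq_le ba/= leNgt; apply/negP => lt_ba; move/negP: n1; apply.
  rewrite ntopE; apply/cards1P; exists i; apply/setP => j.
  rewrite !finset.inE vE tv.
  by case: ifPn => [_|_]; rewrite ?eqxx ?lt_eqF.
by rewrite natr_pred; field; rewrite gt_eqF.
Qed.

End second_price.

(** * The value distribution as two atoms and a density *)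

Section value_distribution.
Context {R : realType} {N : nat}.
Variables (mu : probability R R) (f : R -> R).
Hypothesis N2 : (2 <= N)%N.
Hypothesis mu01 : mu (@Icc01 R) = 1%E.
Hypothesis mf : measurable_fun (@Ioo01 R) f.
Hypothesis f_ge0 : forall x, 0 < x < 1 -> 0 <= f x.
Hypothesis mu_density : forall A : set R, measurable A -> A `<=` @Ioo01 R ->
  mu A = (\int[lebesgue_measure]_(x in A) (f x)%:E)%E.
Local Notation leb := (@lebesgue_measure R).
Local Notation k := ((N.-1)%:R^-1 : R).
Local Notation p := (pw R N).

(* f is arbitrary outside (0, 1). *)
Let f0 : R -> R := f \_ (@Ioo01 R).

Let mf0 : measurable_fun setT f0.
Proof. by apply: ((measurable_restrictT _ _).1 mf); exact: measurable_itv. Qed.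

Let f0_ge0 x : 0 <= f0 x.
Proof.
rewrite /f0 patchE; case: ifPn => // /set_mem; rewrite /Ioo01/= in_itv/=.
exact: f_ge0.
Qed.

Let f0_out x : 1 <= x -> f0 x = 0.
Proof.
move=> x1; rewrite /f0 patchE; case: ifPn => // /set_mem.
by rewrite /Ioo01/= in_itv/= (ltNge x 1) x1 andbF.
Qed.

Let f0E x : 0 < x < 1 -> f0 x = f x.
Proof. by move=> x01; rewrite /f0 patchE mem_set//= /Ioo01/= in_itv/=. Qed.

Let f0_le1 : (\int[leb]_x (f0 x)%:E <= 1)%E.
Proof.
rewrite (_ : (\int[leb]_x _)%E = mu (@Ioo01 R)).
  by apply: probability_le1; exact: measurable_itv.
rewrite mu_density//; last exact: measurable_itv.
rewrite [RHS]integral_mkcond; apply: eq_integral => x _.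
by rewrite /f0 !patchE; case: ifP.
Qed.

Local Notation J := (truncated_moment k f0).
Local Notation Jr x := (fine (truncated_moment k f0 x)).
Local Notation g := (second_density k f0).

Lemma JintE x : x <= 1 -> Jint N f x = J x.
Proof.
move=> x1; apply: eq_integral => s; rewrite inE/= in_itv/= => /andP[s0 sx].
by rewrite f0E ?s0 ?(lt_le_trans sx)// (pwE N2).
Qed.

Let k_gt0 : 0 < k. Proof. exact: pred_inv_gt0. Qed.

Let J_fineK x : (Jr x)%:E = J x.
Proof. exact: (truncated_moment_fineK k_gt0 mf0 f0_ge0 f0_out f0_le1). Qed.

Lemma gdensE b : 0 < b < 1 -> gdens N f b = (g b)%:E.
Proof.
move=> /[dup] b01 /andP[b0 b1]; rewrite /gdens JintE ?(ltW b1)// -J_fineK.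
by rewrite /second_density f0E// (pwE N2) -EFinM -EFinB (mulrC k).
Qed.

Lemma kernel_conditionP : condI N mu f -> kernel_condition k f0.
Proof.
move=> [cI _] b /[dup] b01 /andP[b0 b1]; have := cI b b01.
rewrite JintE ?(ltW b1)// -[X in (_ * X <= _)%E]J_fineK -EFinM lee_fin => h.
rewrite f0E//; apply: le_trans (ler_wpM2l (ltW b0) h).
rewrite le_eqVlt; apply/orP; left; apply/eqP.
rewrite (pwE N2) mulrA; congr (_ * _).
have -> : b `^ (- (1 + k)) = b * b `^ (- 1 - (1 + k)).
  rewrite -{2}(powRr1 (ltW b0)) -powRD ?(gt_eqF b0) ?implybT//.
  by congr (_ `^ _); ring.
by rewrite mulrC mulrA.
Qed.

Let mu1 : R := fine (mu [set 1]).
Let mu0 : R := fine (mu [set 0]).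

Let mu1E : (mu1%:E = mu [set 1%R])%E.
Proof. by rewrite fineK// fin_num_measure. Qed.

Let mu0E : (mu0%:E = mu [set 0%R])%E.
Proof. by rewrite fineK// fin_num_measure. Qed.

Let mu0_ge0 : 0 <= mu0. Proof. by rewrite fine_ge0. Qed.
Let mu1_ge0 : 0 <= mu1. Proof. by rewrite fine_ge0. Qed.

Definition mu_functional (psi : R -> \bar R) : \bar R :=
  (mu0%:E * psi 0%R + \int[leb]_(x in `]0%R, 1%R[) ((f0 x)%:E * psi x)
   + mu1%:E * psi 1%R)%E.

Let Icc_split : @Icc01 R = [set 0] `|` (@Ioo01 R) `|` [set 1].
Proof.
apply/seteqP; split => x; rewrite /Icc01 /Ioo01/= !in_itv/=.
  move=> /andP[]; rewrite le_eqVlt => /predU1P[<- _|x0]; first by left; left.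
  by rewrite le_eqVlt => /predU1P[->|x1]; [right|left; right; rewrite x0].
by move=> [[->|/andP[/ltW -> /ltW ->]]|->]; rewrite ?lexx ?ler01.
Qed.

Lemma mu_indic A : measurable A -> mu A = mu_functional (fun x => (\1_A x)%:E).
Proof.
move=> mA; have mIoo : measurable (@Ioo01 R) by exact: measurable_itv.
have mIcc : measurable (@Icc01 R) by exact: measurable_itv.
have muC0 : mu (~` @Icc01 R) = 0%E.
  by rewrite probability_setC// mu01 subee.
have -> : mu A = mu (A `&` @Icc01 R).
  rewrite -[in LHS](setIT A) -(setUv (@Icc01 R)) setIUr measureU.
  - rewrite [X in (_ + X)%E](_ : _ = 0%E) ?adde0//.
    apply/eqP; rewrite eq_le measure_ge0 andbT -muC0.
    have mC : measurable (~` @Icc01 R) by exact: measurableC.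
    by apply: le_measure; rewrite ?inE//; exact: measurableI.
  - exact: measurableI.
  - by apply: measurableI => //; exact: measurableC.
  - by rewrite setIACA setICr setI0.
have one (c : R) : mu (A `&` [set c]) = ((fine (mu [set c]))%:E * (\1_A c)%:E)%E.
  rewrite fineK ?fin_num_measure// indicE.
  have [/set_mem Ac|/negP Ac] := boolP (c \in A).
    by rewrite mule1 setIidr// => x ->.
  rewrite mule0 (_ : A `&` _ = set0) ?measure0//.
  by apply/seteqP; split => x //= [Ax xc]; apply: Ac; rewrite -xc; exact: mem_set.
rewrite Icc_split !setIUr measureU; last 3 first.
- by apply: measurableU; apply: measurableI.
- exact: measurableI.
- apply/seteqP; split => x //= [[[_ ->]|[_ +]] [_ +]].
    by move=> /eqP; rewrite eq_sym oner_eq0.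
  by rewrite /Ioo01/= in_itv/= => /andP[_ +] E; rewrite E ltxx.
rewrite measureU; last 3 first.
- exact: measurableI.
- exact: measurableI.
- apply/seteqP; split => x //= [[_ ->] [_]].
  by rewrite /Ioo01/= in_itv/= ltxx.
rewrite /mu_functional; congr (_ + _ + _)%E; [exact: one| |exact: one].
rewrite [LHS]mu_density//; last exact: measurableI.
rewrite setIC integral_mkcondr; apply: eq_integral => x; rewrite inE/= => x01.
rewrite patchE indicE f0E; last by move: x01; rewrite /Ioo01/= in_itv.
by case: (x \in A); rewrite ?mule1 ?mule0.
Qed.

(** Representability reduces the claim to indicators: a measure representing the functional exists,
    and [mu_indic] identifies it with [mu]. *)
Lemma integral_mu (psi : R -> \bar R) :
  measurable_fun setT psi -> (forall x, 0 <= psi x)%E ->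
  (\int[mu]_x psi x)%E = mu_functional psi.
Proof.
move=> mpsi psi0.
have [nu hnu] : representable mu_functional.
  have r0 := representable_dirac (NngNum mu0_ge0) (0 : R).
  have r1 := representable_dirac (NngNum mu1_ge0) (1 : R).
  have rf : representable (fun w : R -> \bar R =>
      \int[leb]_(x in `]0%R, 1%R[) ((f0 x)%:E * w x))%E.
    have mid : measurable_fun [set: R] (fun x : R => x) by exact: measurable_id.
    apply: representable_ext
      (representable_density_pushforward leb mid mf0 f0_ge0) => w mw w0.
    rewrite [RHS]integral_mkcond; apply: eq_integral => x _.
    rewrite patchE; case: ifPn => // x01.
    rewrite /f0 patchE (_ : (x \in @Ioo01 R) = (x \in `]0, 1[%classic))//.
    by rewrite (negbTE x01) mul0e.
  exact: (representable_add (representable_add r0 rf) r1).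
rewrite -(hnu _ mpsi psi0); apply: eq_measure_integral => A mA _.
transitivity (mu_functional (fun x => (\1_A x)%:E)); first exact: mu_indic.
rewrite -hnu//.
- by rewrite integral_indic// setIT.
- by apply/measurable_EFinP; exact: measurable_indic.
Qed.

(** The expectation of [X ^ p]; the atom at 0 drops out because [0 ^ p = 0]. *)
Definition revenue_value : R := mu1 + Jr 1.

Lemma integral_mu_pw :
  (\int[mu]_(x in @Icc01 R) (x `^ p)%:E = revenue_value%:E)%E.
Proof.
rewrite integral_mkcond integral_mu; last 2 first.
- apply: ((measurable_restrictT _ _).1 _); first exact: measurable_itv.
  exact: measurable_powR_EFin.
- by move=> x; rewrite patchE; case: ifPn => // _; rewrite lee_fin powR_ge0.
rewrite /mu_functional /revenue_value !patchE.
have -> : 0 \in @Icc01 R by apply: mem_set; rewrite /Icc01/= in_itv/= lexx ler01.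
have -> : 1 \in @Icc01 R by apply: mem_set; rewrite /Icc01/= in_itv/= lexx ler01.
rewrite powR1 powR0 ?gt_eqF ?pw_gt0// mule0 mule1 add0e addeC.
rewrite EFinD; congr (_ + _)%E; rewrite J_fineK; apply: eq_integral => x.
rewrite inE/= in_itv/= => /andP[x0 x1].
by rewrite patchE mem_set ?/Icc01/= ?in_itv/= ?ltW// -EFinM (pwE N2) mulrC.
Qed.

(** * Construction of the adversarial distribution and its marginals *)

Hypothesis cI : condI N mu f.

Let kc : kernel_condition k f0. Proof. exact: kernel_conditionP. Qed.

(** Each bidder has value 1 with probability [mu1], of which [k * J 1] is used by the profiles where
    he alone is at 1. The remainder sits at [(1, ..., 1)]; the second part of condition (I) is its
    nonnegativity. *)
Definition diagonal_mass : R := mu1 - k * Jr 1.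

Lemma diagonal_mass_ge0 : 0 <= diagonal_mass.
Proof.
have := cI.2; rewrite JintE// -J_fineK -mu1E -EFinM lee_fin.
by rewrite subr_ge0.
Qed.

Definition pi_functional (w : profile R N -> \bar R) : \bar R :=
  (mu0%:E * w (prof_const N 0)
   + \sum_(i < N) fiber_integral k f0 (w \o (fun z => prof_top i z.1 z.2))
   + diagonal_mass%:E * w (prof_const N 1))%E.

Lemma measurable_prof_top (i : 'I_N) :
  measurable_fun setT (fun z : R * R => prof_top i z.1 z.2).
Proof.
apply/measurable_fun_tnthP => j.
rewrite (_ : _ \o _ = if j == i then fst else snd); last first.
  by apply/funext => z /=; rewrite tnth_prof_top; case: ifP.
by case: ifP => _; [exact: measurable_fst | exact: measurable_snd].
Qed.

Lemma representable_pi : representable pi_functional.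
Proof.
have r0 := representable_dirac (NngNum mu0_ge0) (prof_const N 0 : profile R N).
have r1 := representable_dirac (NngNum diagonal_mass_ge0) (prof_const N 1 : profile R N).
apply: (representable_add (representable_add r0 _) r1).
apply: (@representable_sum _ _ _ _ _ (fun i w =>
  fiber_integral k f0 (w \o (fun z => prof_top i z.1 z.2)))) => i.
by apply: (representable_fiber k_gt0 mf0 f0_ge0 f0_out f0_le1 kc);
  exact: measurable_prof_top.
Qed.

(** Bidder [i] is on top in one family of profiles and among the lower bidders in the [N - 1]
    others. On (0, 1) the contributions add up to the density, and at 1 the mass [k * J 1] completes
    [diagonal_mass] to [mu1]. *)
Lemma pi_functional_marginal (psi : R -> \bar R) (i : 'I_N) :
  measurable_fun setT psi -> (forall x, 0 <= psi x)%E ->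
  pi_functional (fun v => psi (tnth v i)) = mu_functional psi.
Proof.
move=> mpsi psi0; rewrite /pi_functional /mu_functional !tnth_mktuple.
rewrite -[LHS]addeA -[RHS]addeA.
congr (_ + _)%E; rewrite (bigD1 i)//=.
have -> : fiber_integral k f0 ((fun v => psi (tnth v i)) \o
    (fun z => prof_top i z.1 z.2)) = fiber_integral k f0 (psi \o fst).
  by congr fiber_integral; apply/funext => z /=; rewrite tnth_prof_top eqxx.
have -> : (\sum_(j < N | j != i) fiber_integral k f0 ((fun v => psi (tnth v i)) \o
    (fun z => prof_top j z.1 z.2)) =
    (N.-1)%:R%:E * fiber_integral k f0 (psi \o snd))%E.
  rewrite (eq_bigr (fun=> fiber_integral k f0 (psi \o snd))).
    by rewrite sumr_const cardC1 card_ord mule_natl.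
  move=> j ji; congr fiber_integral; apply/funext => z /=.
  by rewrite tnth_prof_top eq_sym (negbTE ji).
rewrite (fiber_integral_marginal k_gt0 mf0 f0_ge0 f0_out f0_le1 kc)//; last first.
  by rewrite divff// gt_eqF// -invr_gt0.
rewrite -[LHS]addeA; congr (_ + _)%E.
rewrite -ge0_muleDl ?lee_fin ?diagonal_mass_ge0//; last first.
  by rewrite mulr_ge0 ?fine_truncated_moment_ge0// ltW.
by congr (_ * _)%E; rewrite -EFinD addrC subrK.
Qed.

Lemma pi_probability :
  exists P : probability (profile R N) R, represents pi_functional P.
Proof.
have [nu hnu] := representable_pi.
have i0 : 'I_N by exact: Ordinal (ltn_trans (ltnSn 0) N2).
(* The total mass is computed through one coordinate, whose law is [mu]. *)
have nu1 : nu setT = 1%E.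
  rewrite -(@probability_setT _ _ _ mu) mu_indic//.
  rewrite -(@pi_functional_marginal _ i0); last 2 first.
  - by apply/measurable_EFinP; exact: measurable_indic.
  - by move=> x; rewrite lee_fin.
  rewrite -hnu; last 2 first.
  - apply/measurable_EFinP.
    exact: (measurableT_comp (measurable_indic _) (measurable_tnth i0)).
  - by move=> x; rewrite lee_fin.
  rewrite -[LHS](mul1e) -(@integral_cst _ _ _ nu setT measurableT 1%E).
  by apply: eq_integral => v _; rewrite indicE in_setT.
(* Normalization serves only to package [nu] as a probability: its mass is 1, so the values do not
   change and the Dirac fallback is not reached. *)
exists (mnormalize nu (dirac (prof_const N 0 : profile R N))) => w mw w0.
rewrite -hnu//; apply: eq_measure_integral => A mA _.
have nuT : (nu setT == 0)%E || (nu setT == +oo)%E = false.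
  by rewrite nu1 orbF; apply/negbTE; rewrite gt_eqF// lte_fin.
rewrite -[LHS]/(mnormalize nu (dirac (prof_const N 0 : profile R N)) A) /mnormalize nuT nu1.
by rewrite invr1 mule1.
Qed.

Variables (P : probability (profile R N) R) (hP : represents pi_functional P).

Let P_indic A : measurable A -> P A = pi_functional (fun v => (\1_A v)%:E).
Proof.
move=> mA; rewrite -hP.
- by rewrite integral_indic// setIT.
- by apply/measurable_EFinP; exact: measurable_indic.
- by move=> v; rewrite lee_fin.
Qed.

Lemma pi_is_pistar : is_pistar mu f P.
Proof.
move=> A mA; rewrite P_indic// /pi_functional /fiber_integral big_split/= !addeA mu0E.
have add4 (a a' b b' c c' d d' : \bar R) :
    a = a' -> b = b' -> c = c' -> d = d' -> (a + b + c + d = a' + b' + c' + d')%E.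
  by move=> -> -> -> ->.
apply: add4; first by [].
- apply: eq_bigr => i _; apply: eq_integral => a; rewrite inE/= in_itv/= => /andP[a0 a1].
  apply: eq_integral => b; rewrite inE/= in_itv/= => /andP[b0 ba].
  rewrite gdensE ?b0 ?(le_lt_trans ba)//; congr (_ * _%:E * _)%E.
  by rewrite [RHS]invfM.
- apply: eq_bigr => i _; apply: eq_integral => b; rewrite inE/= in_itv/= => b01.
  by rewrite gdensE.
- by rewrite JintE// /diagonal_mass EFinB EFinM J_fineK mu1E.
Qed.

Lemma pi_inPi : inPi mu P.
Proof.
move=> i A mA; rewrite P_indic; last first.
  by rewrite -[X in measurable X]setTI; exact: (measurable_tnth i).
rewrite (mu_indic mA) -(@pi_functional_marginal _ i)//.
apply/measurable_EFinP; exact: measurable_indic.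
Qed.

(** Takes the place of almost-everywhere arguments under the adversarial distribution, whose support
    is explicit. *)
Lemma eq_pi_functional (w w' : profile R N -> \bar R) :
  w (prof_const N 0) = w' (prof_const N 0) ->
  w (prof_const N 1) = w' (prof_const N 1) ->
  (forall i (a b : R), 0 < b -> b <= a -> a <= 1 ->
    w (prof_top i a b) = w' (prof_top i a b)) ->
  pi_functional w = pi_functional w'.
Proof.
move=> w0 w1 wtop; rewrite /pi_functional w0 w1; congr (_ + _ + _)%E.
apply: eq_bigr => i _; rewrite /fiber_integral; congr (_ + _)%E.
  apply: eq_integral => a; rewrite inE/= in_itv/= => /andP[a0 a1].
  apply: eq_integral => b; rewrite inE/= in_itv/= => /andP[b0 ba].
  by rewrite wtop// ltW.
apply: eq_integral => b; rewrite inE/= in_itv/= => /andP[b0 b1].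
by rewrite wtop// ltW.
Qed.

(** * Revenue of the auction under arbitrary and adversarial correlation *)

Lemma ae_cube (Q : probability (profile R N) R) : inPi mu Q ->
  {ae Q, forall v, cube v}.
Proof.
move=> hQ.
have mC : measurable (~` @Icc01 R) by apply: measurableC; exact: measurable_itv.
have muC0 : mu (~` @Icc01 R) = 0%E.
  by rewrite probability_setC ?mu01 ?subee//; exact: measurable_itv.
have neg : Q.-negligible (\big[setU/set0]_(i < N)
    [set v : profile R N | (~` @Icc01 R) (tnth v i)]).
  elim/big_ind : _ => [|A B|i _].
  - exact: negligible_set0.
  - exact: negligibleU.
  exists [set v : profile R N | (~` @Icc01 R) (tnth v i)]; split => //.
    by rewrite -[X in measurable X]setTI; exact: (measurable_tnth i).
  by rewrite hQ.
apply: negligibleS neg => v /= /existsNP[i vi].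
by rewrite (bigD1 i)//=; left; rewrite /Icc01/= in_itv.
Qed.

Let psi : R -> \bar R := (fun x => (x `^ p)%:E) \_ (@Icc01 R).

Let mpsi : measurable_fun setT psi.
Proof.
apply: ((measurable_restrictT _ _).1 _); first exact: measurable_itv.
exact: measurable_powR_EFin.
Qed.

Let psi_ge0 x : (0 <= psi x)%E.
Proof. by rewrite /psi patchE; case: ifPn => // _; rewrite lee_fin powR_ge0. Qed.

Let psiE x : 0 <= x <= 1 -> psi x = (x `^ p)%:E.
Proof. by move=> x01; rewrite /psi patchE mem_set// /Icc01/= in_itv. Qed.

Lemma integral_coordinate (Q : probability (profile R N) R) (i : 'I_N) : inPi mu Q ->
  (\int[Q]_v psi (tnth v i) = revenue_value%:E)%E.
Proof.
move=> hQ; rewrite -integral_mu_pw [RHS]integral_mkcond -[RHS]/(\int[mu]_x psi x)%E.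
have mi : measurable_fun setT (fun v : profile R N => tnth v i).
  exact: measurable_tnth.
have := ge0_integral_pushforward mi Q measurableT mpsi (fun x _ => psi_ge0 x).
rewrite preimage_setT => <-; apply: eq_measure_integral => A mA _.
exact: hQ.
Qed.

Let S (v : profile R N) : \bar R :=
  ((N%:R^-1)%:E * \sum_(i < N) psi (tnth v i))%E.

Let mpsi_tnth (i : 'I_N) : measurable_fun setT (fun v : profile R N => psi (tnth v i)).
Proof. exact: (measurableT_comp mpsi (measurable_tnth i)). Qed.

Let mS : measurable_fun setT S.
Proof. by apply: emeasurable_funM => //; exact: emeasurable_sum. Qed.

Let S_ge0 v : (0 <= S v)%E.
Proof. by rewrite mule_ge0 ?lee_fin ?invr_ge0// sume_ge0. Qed.

Let SE v : cube v -> S v = (N%:R^-1 * \sum_(i < N) tnth v i `^ p)%:E.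
Proof.
move=> cv; rewrite /S EFinM -sumEFin; congr (_ * _)%E.
by apply: eq_bigr => i _; rewrite psiE.
Qed.

Lemma integral_mean_power (Q : probability (profile R N) R) : inPi mu Q ->
  (\int[Q]_v S v = revenue_value%:E)%E.
Proof.
move=> hQ; rewrite ge0_integralZl//; last 2 first.
- exact: emeasurable_sum.
- by move=> v _; exact: sume_ge0.
rewrite ge0_integral_sum//.
under eq_bigr do rewrite integral_coordinate//.
rewrite sumEFin sumr_const card_ord -EFinM; congr EFin.
rewrite -[X in _ * X]mulr_natl mulKf//.
by rewrite pnatr_eq0 -lt0n (ltn_trans _ N2).
Qed.

Let Tstar (v : profile R N) : R := \sum_(i < N) tstar v i.

Let mTstar : measurable_fun setT Tstar.
Proof. by apply: measurable_sum => i; exact: measurable_star. Qed.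

Let S_le v : cube v -> (S v <= (Tstar v)%:E)%E.
Proof. by move=> cv; rewrite SE// lee_fin sum_tstar_ge. Qed.

Let mTstar0 : measurable_fun setT (fun v => (Num.max 0 (Tstar v))%:E).
Proof. by apply/measurable_EFinP; exact: measurable_maxr. Qed.

(** On the cube the revenue dominates the mean of the powers and so is nonnegative. The truncation
    changes it on a null set only and makes it nonnegative everywhere, as [represents] demands. *)
Let U_star (Q : probability (profile R N) R) : inPi mu Q ->
  U Q (@tstar R N) = (\int[Q]_v (Num.max 0 (Tstar v))%:E)%E.
Proof.
move=> hQ; apply: ae_eq_integral => //; first exact/measurable_EFinP.
apply: filterS (ae_cube hQ) => v cv _; rewrite max_r//.
by rewrite -lee_fin; exact: le_trans (S_ge0 v) (S_le cv).
Qed.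

Lemma U_star_ge (Q : probability (profile R N) R) : inPi mu Q ->
  (revenue_value%:E <= U Q (@tstar R N))%E.
Proof.
move=> hQ; rewrite U_star// -(integral_mean_power hQ).
apply: ae_ge0_le_integral => //.
- by move=> v _; rewrite lee_fin le_max lexx.
apply: filterS (ae_cube hQ) => v cv _; apply: le_trans (S_le cv) _.
by rewrite lee_fin le_max lexx orbT.
Qed.

Lemma U_star_pi : U P (@tstar R N) = revenue_value%:E.
Proof.
rewrite (U_star pi_inPi) -(integral_mean_power pi_inPi) !hP//; last first.
  by move=> v; rewrite lee_fin le_max lexx.
have top i (a b : R) : 0 <= b -> b <= a -> a <= 1 ->
    (Num.max 0 (Tstar (prof_top i a b)))%:E = S (prof_top i a b).
  move=> b0 ba a1; have cv : cube (prof_top i a b).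
    by apply: cube_prof_top; rewrite ?b0 ?a1 ?(le_trans b0)// (le_trans ba).
  rewrite SE// -sum_tstar_prof_top// max_r//.
  by rewrite -lee_fin; exact: le_trans (S_ge0 _) (S_le cv).
have i0 : 'I_N by exact: Ordinal (ltn_trans (ltnSn 0) N2).
apply: eq_pi_functional => [||i a b b0 ba a1].
- by rewrite -(prof_top_const i0) top.
- by rewrite -(prof_top_const i0) top.
- by rewrite top// ltW.
Qed.

(** * Revenue of an arbitrary admissible mechanism under the adversarial distribution *)

Section upper_bound.
Variables q t : profile R N -> 'I_N -> R.
Hypothesis qt : admissible q t.

Let T v := \sum_(i < N) t v i.
(** The shortfall from 1. On the cube individual rationality gives [T <= 1], so the truncation acts
    only outside it, while [T] itself may be unbounded below. *)
Let w v : \bar R := (Num.max 0 (1 - T v))%:E.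

Let mT : measurable_fun setT T.
Proof. by case: qt => _ _ _ _ mt; apply: measurable_sum. Qed.

Let mw : measurable_fun setT w.
Proof.
by apply/measurable_EFinP; apply: measurable_maxr => //; exact: measurable_funB.
Qed.

Let w_ge0 v : (0 <= w v)%E. Proof. by rewrite lee_fin le_max lexx. Qed.

Let t_le v i : cube v -> t v i <= tnth v i * q v i.
Proof. by case: qt => _ _ ir _ _ cv; rewrite -subr_ge0 ir// mem_set. Qed.

Let q01 v i : cube v -> 0 <= q v i <= 1.
Proof. by case: qt => fe _ _ _ _ cv; apply: (fe v _).1; exact: mem_set. Qed.

Let T_le1 v : cube v -> T v <= 1.
Proof.
move=> cv; case: qt => fe _ _ _ _.
apply: le_trans (fe v (mem_set cv)).2; apply: ler_sum => i _.
apply: le_trans (t_le i cv) _; have /andP[q0 _] := q01 i cv.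
by rewrite ler_piMl//; have /andP[] := cv i.
Qed.

Let fiber_bound i : (fiber_integral k f0 (cst 1%E) <=
  fiber_integral k f0 (w \o (fun z => prof_top i z.1 z.2)) + (k * Jr 1)%:E)%E.
Proof.
apply: (fiber_integral_ge k_gt0 mf0 f0_ge0 f0_out f0_le1 kc).
- exact: (measurableT_comp mw (measurable_prof_top i)).
- by move=> z; exact: w_ge0.
move=> b b01; have /andP[b0 b1] := b01.
have cb (a : R) : 0 <= a <= 1 -> cube (prof_top i a b).
  by move=> a01; apply: cube_prof_top; rewrite // !ltW.
have tt (a : R) : tnth (prof_top i a b) i = a by rewrite tnth_prof_top eqxx.
case: qt => _ ic ir ex _.
apply: (mechanism_bound (q := fun a => q (prof_top i a b) i)
  (tau := fun a => t (prof_top i a b) i)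
  (W := fun a => Num.max 0 (1 - T (prof_top i a b)))) => //.
- move=> x y x01 y01; have := ic i _ x (mem_set (cb y y01)) x01.
  by rewrite upd_prof_top tt.
- by move=> x x01; have := ir i _ (mem_set (cb x x01)); rewrite tt.
- by move=> x x01; have /andP[] := q01 i (cb x x01).
- apply/measurable_EFinP.
  exact: (measurableT_comp (measurableT_comp mw (measurable_prof_top i)) (pair2_measurable b)).
- by move=> a; rewrite le_max lexx.
- move=> a /andP[ba a1]; rewrite le_max; apply/orP; right.
  have ca : cube (prof_top i a b) by apply: cb; rewrite a1 (ltW (lt_trans b0 ba)).
  (* For [a > b] exclusivity gives the others nothing, and individual rationality makes their
     payments nonpositive, so [T] is at most the payment of [i]. *)
  rewrite lerD2l lerN2 /T (bigD1 i)//= gerDl; apply: sumr_le0 => j ji.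
  apply: le_trans (t_le j ca) _; rewrite (ex j _ (mem_set ca)) ?mulr0//.
  by exists i; rewrite tt tnth_prof_top (negbTE ji).
Qed.

(** The budget of the bound: [k * J 1] from the fibres of each of the [N] bidders, plus the atom at
    [(1, ..., 1)]. *)
Let revenue_valueE : revenue_value = N%:R * (k * Jr 1) + diagonal_mass.
Proof.
rewrite /revenue_value /diagonal_mass mulrA.
have -> : N%:R * k = 1 + k by rewrite -(pwE N2).
by ring.
Qed.

Let integral_one : (\int[P]_v cst 1%E v = 1)%E.
Proof. by rewrite integral_cst// mul1e; exact: probability_setT. Qed.

Let pi_functional1 : pi_functional (cst 1%E) = 1%E.
Proof. by rewrite -hP. Qed.

Let w_lower : (1 <= pi_functional w + revenue_value%:E)%E.
Proof.
rewrite -pi_functional1 revenue_valueE EFinD /pi_functional /= !mule1.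
(* The atom at [(1, ..., 1)] is paid for in full by [diagonal_mass], since there the shortfall is
   just nonnegative. *)
rewrite [leRHS]addeACA; apply: leeD; last first.
  rewrite leeDr// mule_ge0//.
  by rewrite lee_fin diagonal_mass_ge0.
(* At the zero profile no payment is positive, so the shortfall is at least 1 and this atom yields
   no revenue. *)
rewrite -[leRHS]addeA; apply: leeD.
  rewrite -[leLHS]mule1 lee_wpmul2l// lee_fin le_max; apply/orP; right.
  rewrite lerBrDl gerDr; apply: sumr_le0 => i _.
  have c0 : cube (prof_const N (0 : R)).
    by move=> j; rewrite tnth_mktuple lexx ler01.
  by apply: le_trans (t_le i c0) _; rewrite tnth_mktuple mul0r.
apply: (@le_trans _ _ (\sum_(i < N) (fiber_integral k f0
    (w \o (fun z => prof_top i z.1 z.2)) + (k * Jr 1)%:E))%E).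
  by apply: lee_sum => i _; exact: fiber_bound.
rewrite big_split/= leeD2l// sumEFin sumr_const card_ord.
by rewrite lee_fin -[leLHS]mulr_natl.
Qed.

Lemma U_le_pi : (U P t <= revenue_value%:E)%E.
Proof.
have -> : U P t = (\int[P]_v (T v)%:E)%E by [].
rewrite integralE.
pose Tp v : \bar R := (Num.max 0 (T v))%:E.
pose Tn v : \bar R := (Num.max 0 (- T v))%:E.
have mTp : measurable_fun setT Tp.
  by apply/measurable_EFinP; exact: measurable_maxr.
have mTn : measurable_fun setT Tn.
  by apply/measurable_EFinP; apply: measurable_maxr => //; exact: measurableT_comp.
have Tp0 v : (0 <= Tp v)%E by rewrite lee_fin le_max lexx.
have Tn0 v : (0 <= Tn v)%E by rewrite lee_fin le_max lexx.
have -> : (\int[P]_v (fun v => (T v)%:E)^\+ v = \int[P]_v Tp v)%E.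
  by apply: eq_integral => v _; rewrite funeposE /Tp EFin_max maxC.
have -> : (\int[P]_v (fun v => (T v)%:E)^\- v = \int[P]_v Tn v)%E.
  by apply: eq_integral => v _; rewrite funenegE /Tn EFin_max maxC.
(* On the cube [w = 1 - T]; moving the negative part to the other side gives an identity between
   nonnegative functions, integrable term by term even if revenue is not. *)
have balance : (\int[P]_v w v + \int[P]_v Tp v = 1 + \int[P]_v Tn v)%E.
  rewrite -ge0_integralD//.
  rewrite -integral_one.
  rewrite -ge0_integralD//; apply: ae_eq_integral => //.
  - exact: emeasurable_funD.
  - exact: emeasurable_funD.
  apply: filterS (ae_cube pi_inPi) => v cv _; rewrite /w /Tp /Tn -!EFinD.
  have T1 := T_le1 cv; congr EFin; rewrite max_r ?subr_ge0//.
  have [T0|T0] := leP 0 (T v).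
    by rewrite max_l; lra.
  by rewrite max_r; lra.
have Tp_le1 : (\int[P]_v Tp v <= 1)%E.
  rewrite -integral_one.
  apply: ae_ge0_le_integral => //.
  apply: filterS (ae_cube pi_inPi) => v cv _.
  by rewrite lee_fin ge_max ler01 T_le1.
have Tpf : (\int[P]_v Tp v \is a fin_num)%E.
  rewrite ge0_fin_numE ?integral_ge0//.
  by apply: le_lt_trans Tp_le1 _; rewrite ltry.
have w_int0 : (0 <= \int[P]_v w v)%E by exact: integral_ge0.
have Tn_int0 : (0 <= \int[P]_v Tn v)%E by exact: integral_ge0.
move: balance w_lower w_int0 Tn_int0; rewrite -hP//.
move: Tpf; case: (\int[P]_v Tp v)%E => // b _.
(* The positive part has a finite integral, so an infinite negative part makes the revenue [-oo];
   otherwise everything is real and [w_lower] concludes. *)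
case: (\int[P]_v Tn v)%E => [c||]//; last by move=> *; exact: leNye.
case: (\int[P]_v w v)%E => [a||]//.
rewrite -!EFinD => -[E]; rewrite !lee_fin => h _ _; lra.
Qed.

End upper_bound.

End value_distribution.

(** * Condition (II) implies (I), and the equilibrium *)

Lemma condII_condI (R : realType) (N : nat) (mu : probability R R) (f : R -> R) :
  (2 <= N)%N -> measurable_fun (@Ioo01 R) f ->
  (forall x, 0 < x < 1 -> 0 <= f x) -> condII N mu f -> condI N mu f.
Proof.
move=> N2 mf f0 [mono top]; split => // x /andP[x0 x1].
set k : R := (N.-1)%:R^-1.
have k0 : 0 < k by exact: pred_inv_gt0.
have sub01 (s : R) : 0 < s -> s < x -> 0 < s < 1.
  by move=> s0 sx; rewrite s0 (lt_trans sx).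
have fx : 0 <= x ^+ 2 * f x by rewrite mulr_ge0 ?sqr_ge0// f0// x0.
have mpow (D : set R) : measurable_fun D (fun s : R => (s `^ (k - 1))%:E).
  exact: measurable_powR_EFin.
(* Write [s ^ p * f s] as [s^2 * f s * s ^ (k - 1)] and bound [s^2 * f s] by its value at [x]. Since
   [- 1 - p = - 2 - k], the factor in condition (I) turns this bound into exactly [f x]. *)
have Jle : (Jint N f x <= (x ^+ 2 * f x * (x `^ k / k))%:E)%E.
  apply: (@le_trans _ _ (\int[lebesgue_measure]_(s in `]0%R, x[)
      ((x ^+ 2 * f x)%:E * (s `^ (k - 1))%:E))%E).
    apply: ge0_le_integral => //.
    - move=> s; rewrite /= in_itv/= => /andP[s0 sx].
      by rewrite lee_fin mulr_ge0 ?powR_ge0// f0// sub01.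
    - apply/measurable_EFinP; apply: measurable_funM; first exact: measurable_funTS.
      apply: measurable_funS mf; first exact: measurable_itv.
      by move=> s; rewrite /= !in_itv/= => /andP[s0 sx]; exact: sub01.
    - by apply: emeasurable_funM => //; exact: mpow.
    - move=> s; rewrite /= in_itv/= => /andP[s0 sx].
      rewrite -EFinM lee_fin.
      have -> : s `^ pw R N = s ^+ 2 * s `^ (k - 1).
        rewrite (pwE N2) -powR_mulrn ?ltW// -powRD ?(gt_eqF s0) ?implybT//.
        by congr (_ `^ _); rewrite /k; ring.
      rewrite mulrAC ler_wpM2r ?powR_ge0//.
      by apply: mono => //; exact: ltW.
  rewrite ge0_integralZl//; last 2 first.
  - exact: mpow.
  - by move=> s _; rewrite lee_fin powR_ge0.
  rewrite [leRHS]EFinM lee_wpmul2l ?lee_fin//.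
  exact: integral_powR_le.
have : (0 <= Jint N f x)%E.
  apply: integral_ge0 => s; rewrite /= in_itv/= => /andP[s0 sx].
  by rewrite lee_fin mulr_ge0 ?powR_ge0// f0// sub01.
case: (Jint N f x) Jle => [j||]//; rewrite -EFinM !lee_fin => jle j0.
have c0 : 0 <= x `^ (- 1 - pw R N) / (N.-1)%:R.
  by rewrite mulr_ge0 ?powR_ge0// -/k ltW.
apply: le_trans (ler_wpM2l c0 jle) _; rewrite le_eqVlt; apply/orP; left; apply/eqP.
have -> : x `^ (- 1 - pw R N) = (x ^+ 2 * x `^ k)^-1.
  rewrite -powR_mulrn ?ltW// -powRD ?(gt_eqF x0) ?implybT// -powRN (pwE N2) -/k.
  by congr (_ `^ _); ring.
have pk : x `^ k != 0 by rewrite gt_eqF// powR_gt0.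
by rewrite -/k; field; rewrite pk !gt_eqF.
Qed.

Theorem theorem2 (R : realType) (N : nat) (mu : probability R R) (f : R -> R) :
  (2 <= N)%N ->
  (* F is supported in [0,1], with support exactly [0,1] *)
  mu (@Icc01 R) = 1%E ->
  (forall a b : R, 0 <= a -> a < b -> b <= 1 -> (0 < mu (Ioo a b))%E) ->
  (* on (0,1), F is absolutely continuous with density f *)
  measurable_fun (@Ioo01 R) f ->
  (forall x, 0 < x < 1 -> 0 <= f x) ->
  (forall A : set R, measurable A -> A `<=` (@Ioo01 R) ->
     mu A = (\int[lebesgue_measure]_(x in A) (f x)%:E)%E) ->
  (condI N mu f ->
     exists Pstar : probability (profile R N) R,
       is_pistar mu f Pstar /\
       [/\ inPi mu Pstar,
           admissible (@qstar R N) (@tstar R N),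
           (forall P : probability (profile R N) R,
              inPi mu P -> (U Pstar (@tstar R N) <= U P (@tstar R N))%E),
           (forall q t : profile R N -> 'I_N -> R,
              admissible q t -> (U Pstar t <= U Pstar (@tstar R N))%E) &
           ereal_inf [set U P (@tstar R N) |
                        P in [set P : probability (profile R N) R | inPi mu P]]
           = (\int[mu]_(x in @Icc01 R) (x `^ pw R N)%:E)%E])
  /\ (condII N mu f -> condI N mu f).
Proof.
move=> N2 mu01 _ mf f_ge0 mu_density; split; last exact: condII_condI.
move=> cI; have [P hP] := pi_probability N2 mu01 mf f_ge0 mu_density cI.
have PPi := pi_inPi N2 mu01 mf f_ge0 mu_density cI hP.
have UP := U_star_pi N2 mu01 mf f_ge0 mu_density cI hP.
have Uge := U_star_ge N2 mu01 mf f_ge0 mu_density.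
exists P; split; first exact: (pi_is_pistar N2 mf f_ge0 mu_density hP).
split => //.
- exact: star_admissible.
- by move=> Q hQ; rewrite UP; exact: Uge.
- move=> q t qt; rewrite UP.
  exact: (U_le_pi N2 mu01 mf f_ge0 mu_density cI hP qt).
- rewrite (integral_mu_pw N2 mu01 mf f_ge0 mu_density).
  (* The infimum is attained at the adversarial distribution, where the lower bound valid for all
     correlations is an equality. *)
  apply/eqP; rewrite eq_le; apply/andP; split.
    by apply: ereal_inf_lbound; exists P.
  by apply: le_ereal_inf_tmp => _ [Q hQ <-]; exact: Uge.
Qed.
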